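(* The following asymptotics hold as $R=\rho(z,0)\to\infty$ (equivalently $|z|\to1$), for every $n\in\mathbb N_0$. (A) If $\lambda\in\mathbb C\setminus(-\infty,-\frac14]$ then $$ \Phi_n(z\,|\,\lambda)\sim\frac{c(\lambda)}{n!\,\bigl(2s(\lambda)\bigr)^n}\,R^n\exp\Bigl(\bigl(s(\lambda)-\tfrac12\bigr)R\Bigr), $$ where $c(\lambda)\neq0$ is a constant depending only on $\lambda$. (B) If $\lambda=-\frac14$ then $$ \Phi_n(z\,|\,\lambda)\sim\frac{2}{(2n+1)!\,\pi}\,R^{2n+1}\exp(-R/2). $$ In particular, for every $n\ge1$ and $\lambda\in\mathbb C\setminus(-\infty,-\frac14)$ there is $0<r_{n,\lambda}<1$ such that $\Phi_n(z\,|\,\lambda)\neq0$ for all $z\in\mathbb D$ with $|z|\ge r_{n,\lambda}$.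
   Context: $\mathbb D$ is the open unit disk in $\mathbb C$, $\partial\mathbb D$ the unit circle, $\mathbb N_0=\{0,1,2,\dots\}$. $\rho$ is the hyperbolic metric; $\rho(z,0)=\log\frac{1+|z|}{1-|z|}$. The Poisson kernel is $P(z,\xi)=\frac{1-|z|^2}{|\xi-z|^2}$, and $\mathfrak h(z,\xi)=-\log P(z,\xi)$. For $\lambda\in\mathbb C$, $s(\lambda)=\sqrt{\lambda+\frac14}$, where the square root of $re^{i\phi}$ ($r\ge0$, $\phi\in(-\pi,\pi]$) is $\sqrt r\,e^{i\phi/2}$. Define $P_n(z,\xi\,|\,\lambda)=\frac{1}{n!(2s(\lambda))^n}(-\mathfrak h(z,\xi))^nP(z,\xi)^{s(\lambda)+1/2}$ if $\lambda\ne-\frac14$, and $P_n(z,\xi\,|-\frac14)=\frac1{(2n)!}\mathfrak h(z,\xi)^{2n}P(z,\xi)^{1/2}$. The $n$-th $\lambda$-polyspherical function is $\Phi_n(z\,|\,\lambda)=\int_{\partial\mathbb D}P_n(z,\xi\,|\,\lambda)\,d\xi$, where $d\xi$ is integration with respect to the normalised Lebesgue measure on the unit circle; it depends only on $|z|$. The notation $f\sim g$ means $f/g\to1$. *)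

(* Defs.v *)
From Stdlib Require Import Reals Lra Factorial.
From Coquelicot Require Import Coquelicot.
Open Scope R_scope.

Definition Cexp (z : C) : C :=
  (exp (Re z) * cos (Im z), exp (Re z) * sin (Im z)).

(** Principal argument, in ]-PI, PI]; the value at 0 is irrelevant. *)
Definition Carg (z : C) : R :=
  if Rle_dec 0 (Im z) then acos (Re z / Cmod z) else - acos (Re z / Cmod z).

Definition Csqrt (z : C) : C :=
  (sqrt (Cmod z) * Cexp (Ci * (Carg z / 2)%R))%C.

Lemma Cmod_polar (r phi : R) :
  0 <= r -> Cmod (r * Cexp (Ci * phi))%C = r.
Proof.
intros Hr. rewrite Cmod_mult, Cmod_R, Rabs_pos_eq by exact Hr.
unfold Cexp, Cmod; simpl.
replace (_ + _) with 1; [rewrite sqrt_1; ring|].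
replace (0 * phi - 1 * 0) with 0 by ring.
replace (0 * 0 + 1 * phi) with phi by ring.
rewrite exp_0. generalize (sin2_cos2 phi); unfold Rsqr; lra.
Qed.

Lemma Carg_polar (r phi : R) :
  0 < r -> - PI < phi <= PI -> Carg (r * Cexp (Ci * phi))%C = phi.
Proof.
intros Hr Hphi. unfold Carg. rewrite Cmod_polar by lra.
unfold Cexp; simpl.
replace (0 * phi - 1 * 0) with 0 by ring.
replace (0 * 0 + 1 * phi) with phi by ring.
rewrite exp_0.
replace ((r * (1 * cos phi) - 0 * (1 * sin phi)) / r) with (cos phi)
  by (field; lra).
replace (r * (1 * sin phi) + 0 * (1 * cos phi)) with (r * sin phi) by ring.
destruct (Rle_dec 0 phi) as [H0|H0].
- assert (Hs : 0 <= sin phi) by (apply sin_ge_0; lra).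
  destruct Rle_dec as [_|Hn]; [apply acos_cos; lra|].
  exfalso; apply Hn; apply Rmult_le_pos; lra.
- assert (Hs : 0 < sin (- phi)) by (apply sin_gt_0; lra).
  rewrite sin_neg in Hs.
  destruct Rle_dec as [Hn|_].
  + exfalso; assert (0 < r * - sin phi) by (apply Rmult_lt_0_compat; lra); lra.
  + rewrite <- cos_neg, acos_cos; lra.
Qed.

Lemma Csqrt_polar (r phi : R) :
  0 <= r -> - PI < phi <= PI ->
  Csqrt (r * Cexp (Ci * phi))%C = (sqrt r * Cexp (Ci * (phi / 2)%R))%C.
Proof.
intros Hr Hphi. unfold Csqrt. rewrite Cmod_polar by exact Hr.
destruct Hr as [Hr|<-].
- now rewrite Carg_polar.
- now rewrite sqrt_0, !Cmult_0_l.
Qed.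

(** [x ^ w] for a real base [0 < x] and a complex exponent. *)
Definition Rcpow (x : R) (w : C) : C := Cexp (w * ln x)%C.

Definition in_disk (z : C) : Prop := Cmod z < 1.

Definition hyp_dist (z w : C) : R :=
  let delta := Cmod (z - w)%C / Cmod (1 - Cconj w * z)%C in
  ln ((1 + delta) / (1 - delta)).

Lemma hyp_dist_0 (z : C) : hyp_dist z 0 = ln ((1 + Cmod z) / (1 - Cmod z)).
Proof.
unfold hyp_dist.
replace (1 - Cconj 0 * z)%C with (RtoC 1)
  by (apply injective_projections; simpl; ring).
replace (z - 0)%C with z by ring.
now rewrite Cmod_1, Rdiv_1_r.
Qed.

Definition hyp_infty (P : C -> Prop) : Prop :=
  exists M : R, forall z : C, in_disk z -> M < hyp_dist z 0 -> P z.

Global Instance hyp_infty_proper : ProperFilter hyp_infty.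
Proof.
split; [|split].
- intros P [M HM].
  set (t := exp (Rmax M 0 + 1)).
  assert (Ht : 1 < t).
  { rewrite <- exp_0. apply exp_increasing. generalize (Rmax_r M 0); lra. }
  set (x := (t - 1) / (t + 1)).
  assert (Hx0 : 0 <= x) by (apply Rdiv_le_0_compat; lra).
  assert (Hx1 : x < 1) by (apply (Rdiv_lt_1 (t - 1) (t + 1)); lra).
  assert (Hm : Cmod x = x) by (rewrite Cmod_R; now apply Rabs_pos_eq).
  exists (RtoC x). apply HM; [unfold in_disk; now rewrite Hm|].
  rewrite hyp_dist_0, Hm.
  replace ((1 + x) / (1 - x)) with t by (unfold x; field; lra).
  unfold t; rewrite ln_exp. generalize (Rmax_l M 0); lra.
- now exists 0.
- intros P Q [M HM] [N HN]. exists (Rmax M N). intros z Hz Hlt.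
  generalize (Rmax_l M N) (Rmax_r M N); intros H1 H2.
  split; [apply HM | apply HN]; trivial; lra.
- intros P Q HPQ [M HM]. exists M. auto.
Qed.

Definition asymp_equiv (F : (C -> Prop) -> Prop) (f g : C -> C) : Prop :=
  filterlim (fun z : C => (f z / g z)%C) F (locally (RtoC 1)).

(** Integral against the normalised Lebesgue measure of the unit circle,
    written as a Riemann integral through [xi = exp (i theta)]; it is used on
    integrands continuous in [theta] only. *)
Definition circle_int (f : C -> C) : C :=
  (/ (2 * PI)%R *
   RInt (V := C_R_CompleteNormedModule)
        (fun theta : R => f (Cexp (Ci * theta)%C)) 0 (2 * PI))%C.

Definition poisson (z xi : C) : R :=
  (1 - Cmod z ^ 2) / Cmod (xi - z)%C ^ 2.

Definition horo (z xi : C) : R := - ln (poisson z xi).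

Definition spec_s (lambda : C) : C := Csqrt (lambda + 1 / 4)%C.

Definition P_poly (n : nat) (z xi lambda : C) : C :=
  if Ceq_dec lambda (- (1 / 4))%C then
    (/ INR (fact (2 * n)) * horo z xi ^ (2 * n) *
     Rcpow (poisson z xi) (1 / 2))%C
  else
    (/ (INR (fact n) * (2 * spec_s lambda) ^ n) * (- horo z xi)%R ^ n *
     Rcpow (poisson z xi) (spec_s lambda + 1 / 2))%C.

Definition Phi (n : nat) (z lambda : C) : C :=
  circle_int (fun xi : C => P_poly n z xi lambda).

(* Main.v *)
Require Import Defs.
From Stdlib Require Import Reals Factorial Lra Lia.
From Coquelicot Require Import Coquelicot.
Open Scope R_scope.

(** Put [R = rho (z, 0)].  The substitution [tan (t / 2) = e^(x - R)] turns the
    Poisson kernel into [P = cosh (R - x) / cosh x] and [dt] into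
    [dx / cosh (R - x)].

    Write [s] for [s(lambda)], with [Re s > 0].  The integrand [(log P)^n P^(s+1/2)] divided
    by [R^n e^((s-1/2) R)] converges locally uniformly to
    [2 e^x (1 + e^(2x))^(-s-1/2)] and, because [|log P| <= R], it is dominated by
    [2 e^(- min (1, 2 Re s) |x|)].  The limit [J s] of the integrals satisfies
    [2 s J s = (2 s + 1) J (s + 1)], so a zero of [J] would propagate to [s + k] for
    all [k], whereas [Re (J w) > 0] as soon as [Re w > 1 + |Im w|].

    At [lambda = -1/4] the mass sits on [0 <= x <= R], where [log P] differs from
    [R - 2 x], and [e^(R / 2) sqrt P / cosh (R - x)] from [2], by at most
    [e^(- 2 x) + e^(- 2 (R - x))]; this gives [2 e^(- R / 2)] times the integral of
    [(R - 2 x)^(2n)] up to a relative error [O (1 / R)]. *)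

(** * Integrals of complex-valued functions *)

(** The power [R^n] in (A) appears because [log P / R -> 1] at fixed [x]: in this coordinate the
    part of the circle that carries the integral stays in place while [R] grows, so a limit under
    the integral sign becomes possible. The condition [Re s > 0] is what makes the limit kernel
    decay at [+oo]. At [s = 0] the kernel tends to [2] there, no integrable majorant is left, and an
    explicit error estimate replaces dominated convergence. This is the origin of the extra power of
    [R] in (B); its constant comes from the integral of [(R - 2 x)^(2n)] over [[0, R]], which is
    [R^(2n+1) / (2n+1)].

    For complex [s] the integrand of [J s] oscillates, so non-vanishing does not follow from
    positivity. Moving to [s + k] helps because for large [Re w] the mass of the kernel sits where
    [log (1 + e^(2x))] is of order [1 / Re w], so that the phase is only of order
    [|Im w| / Re w]. *)

Definition Rcont (f : R -> R) : Prop := forall x, continuous f x.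

(** Continuity on the whole line settles integrability on every interval at once. The target is the
    real module structure on [C], the one in which [RInt] takes its values. *)
Definition Ccont (f : R -> C) : Prop :=
  forall x, continuous (U := C_R_NormedModule) f x.

Definition CInt (f : R -> C) (a b : R) : C :=
  RInt (V := C_R_CompleteNormedModule) f a b.

Lemma norm_C_R (z : C) : norm (V := C_R_NormedModule) z = Cmod z.
Proof.
  destruct z as [x y]. unfold Cmod; simpl fst; simpl snd.
  change (sqrt (Rabs x ^ 2 + Rabs y ^ 2) = sqrt (x ^ 2 + y ^ 2)).
  now rewrite !pow2_abs.
Qed.

Lemma filterlim_C {T : Type} (F : (T -> Prop) -> Prop) {FF : Filter F}
    (f : T -> C) (l : C) :
  filterlim f F (locally (T := C_UniformSpace) l) <->
  (forall eps, 0 < eps -> F (fun x => Cmod (f x - l)%C < eps)).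
Proof.
  split.
  - intros H eps Heps.
    (* The balls of [C] are squares, so passing to [Cmod] costs a factor [sqrt 2 < 2]. *)
    assert (H2 : 0 < eps / 2) by lra.
    pose proof (proj1 (filterlim_locally f l) H (mkposreal _ H2)) as H1.
    revert H1. apply filter_imp. intros x Hx.
    apply C_NormedModule_mixin_compat2 in Hx. simpl in Hx.
    change (Cmod (f x - l)%C < sqrt 2 * (eps / 2)) in Hx.
    assert (sqrt 2 < 2).
    { replace 2 with (sqrt (2*2)) at 2 by (apply sqrt_square; lra).
      apply sqrt_lt_1; lra. }
    eapply Rlt_trans; [exact Hx|]. nra.
  - intros H. apply filterlim_locally. intros eps.
    generalize (H eps (cond_pos eps)). apply filter_imp. intros x Hx.
    now apply C_NormedModule_mixin_compat1.
Qed.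

Lemma Rcont_derive (f : R -> R) : (forall x, ex_derive f x) -> Rcont f.
Proof. intros H x. now apply (ex_derive_continuous f). Qed.

Lemma Ccont_components (f : R -> C) :
  Ccont f <-> Rcont (fun x => Re (f x)) /\ Rcont (fun x => Im (f x)).
Proof.
  split.
  - intros H; split; intros x.
    + apply (continuous_comp (V := C_R_NormedModule) f (fun z : R * R => fst z)).
      * apply H.
      * apply continuous_fst.
    + apply (continuous_comp (V := C_R_NormedModule) f (fun z : R * R => snd z)).
      * apply H.
      * apply continuous_snd.
  - intros [H1 H2] x.
    apply continuous_ext with (fun y => (Re (f y), Im (f y)) : C_R_NormedModule).
    + intros y. now destruct (f y).
    + intros P HP. destruct HP as [eps HP].
      pose proof (proj1 (filterlim_locally _ _) (H1 x) eps) as K1.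
      pose proof (proj1 (filterlim_locally _ _) (H2 x) eps) as K2.
      generalize (filter_and _ _ K1 K2). unfold filtermap.
      apply filter_imp. intros y [Y1 Y2]. apply HP. split; assumption.
Qed.

Lemma Ccont_RtoC (f : R -> R) : Rcont f -> Ccont (fun x => RtoC (f x)).
Proof.
  intros H. apply Ccont_components. split; simpl.
  - exact H.
  - intros x; apply continuous_const.
Qed.

Lemma Rcont_mult (f g : R -> R) : Rcont f -> Rcont g -> Rcont (fun x => f x * g x).
Proof. intros Hf Hg x. now apply (continuous_mult (K := R_AbsRing)). Qed.

Lemma Rcont_plus (f g : R -> R) : Rcont f -> Rcont g -> Rcont (fun x => f x + g x).
Proof. intros Hf Hg x. now apply (continuous_plus (V := R_NormedModule)). Qed.

Lemma Rcont_minus (f g : R -> R) : Rcont f -> Rcont g -> Rcont (fun x => f x - g x).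
Proof. intros Hf Hg x. now apply (continuous_minus (V := R_NormedModule)). Qed.

Lemma Rcont_const (k : R) : Rcont (fun _ => k).
Proof. intros x. apply continuous_const. Qed.

Lemma Rcont_comp (f g : R -> R) : Rcont f -> Rcont g -> Rcont (fun x => g (f x)).
Proof. intros Hf Hg x. now apply continuous_comp. Qed.

Lemma Ccont_comp (f : R -> R) (g : R -> C) :
  Rcont f -> Ccont g -> Ccont (fun x => g (f x)).
Proof. intros Hf Hg x. now apply continuous_comp. Qed.

Lemma Rcont_pow (f : R -> R) (n : nat) : Rcont f -> Rcont (fun x => f x ^ n).
Proof.
  intros Hf. apply (Rcont_comp f (fun y => y ^ n)); [exact Hf|].
  apply Rcont_derive. intros x. auto_derive. exact I.
Qed.

Lemma Ccont_mult (f g : R -> C) : Ccont f -> Ccont g -> Ccont (fun x => (f x * g x)%C).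
Proof.
  intros [F1 F2]%Ccont_components [G1 G2]%Ccont_components.
  apply Ccont_components; split; simpl.
  - apply Rcont_minus; apply Rcont_mult; assumption.
  - apply Rcont_plus; apply Rcont_mult; assumption.
Qed.

Lemma Ccont_plus (f g : R -> C) : Ccont f -> Ccont g -> Ccont (fun x => (f x + g x)%C).
Proof.
  intros [F1 F2]%Ccont_components [G1 G2]%Ccont_components.
  apply Ccont_components; split; simpl; apply Rcont_plus; assumption.
Qed.

Lemma Ccont_minus (f g : R -> C) : Ccont f -> Ccont g -> Ccont (fun x => (f x - g x)%C).
Proof.
  intros [F1 F2]%Ccont_components [G1 G2]%Ccont_components.
  apply Ccont_components; split; simpl; apply Rcont_minus; assumption.
Qed.

Lemma Ccont_const (k : C) : Ccont (fun _ => k).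
Proof. intros x. apply continuous_const. Qed.

Lemma Ccont_Cexp (w : C) (f : R -> R) : Rcont f -> Ccont (fun x => Cexp (w * f x)%C).
Proof.
  intros Hf. apply (Ccont_comp f (fun y => Cexp (w * y)%C)); [exact Hf|].
  apply Ccont_components; split; simpl; apply Rcont_derive; intros x;
    auto_derive; repeat split.
Qed.

Lemma ex_RInt_Rcont (f : R -> R) (a b : R) : Rcont f -> ex_RInt f a b.
Proof. intros H. apply (ex_RInt_continuous (V := R_CompleteNormedModule)). auto. Qed.

Lemma ex_RInt_Ccont (f : R -> C) (a b : R) :
  Ccont f -> ex_RInt (V := C_R_NormedModule) f a b.
Proof. intros H. apply (ex_RInt_continuous (V := C_R_CompleteNormedModule)). intros; apply H. Qed.

Lemma CInt_components (f : R -> C) (a b : R) : Ccont f ->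
  CInt f a b = (RInt (fun x => Re (f x)) a b, RInt (fun x => Im (f x)) a b).
Proof.
  intros [F1 F2]%Ccont_components.
  apply (is_RInt_unique (V := C_R_CompleteNormedModule)).
  apply (is_RInt_fct_extend_pair (U := R_NormedModule) (V := R_NormedModule));
    apply (RInt_correct (V := R_CompleteNormedModule)); now apply ex_RInt_Rcont.
Qed.

Lemma CInt_RtoC (f : R -> R) (a b : R) : Rcont f ->
  CInt (fun x => RtoC (f x)) a b = RtoC (RInt f a b).
Proof.
  intros H. rewrite CInt_components by now apply Ccont_RtoC. unfold RtoC; simpl. f_equal.
  rewrite RInt_const. unfold scal; simpl; unfold mult; simpl. ring.
Qed.

Lemma CInt_ext (f g : R -> C) (a b : R) :
  (forall x, f x = g x) -> CInt f a b = CInt g a b.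
Proof. intros H. apply (RInt_ext (V := C_R_CompleteNormedModule)). intros; apply H. Qed.

Lemma CInt_Chasles (f : R -> C) (a b c : R) : Ccont f ->
  (CInt f a b + CInt f b c)%C = CInt f a c.
Proof.
  intros H. apply (RInt_Chasles (V := C_R_CompleteNormedModule)); now apply ex_RInt_Ccont.
Qed.

(** The scalar is complex but the integral lives in a real module, so linearity is checked on
    components. *)
Lemma CInt_scal (k : C) (f : R -> C) (a b : R) : Ccont f ->
  CInt (fun x => (k * f x)%C) a b = (k * CInt f a b)%C.
Proof.
  intros H. pose proof H as [F1 F2]%Ccont_components.
  rewrite (CInt_components f), CInt_components
    by (assumption || (apply Ccont_mult; [apply Ccont_const | assumption])).
  assert (S : forall (u : R) (g : R -> R), Rcont g ->
     RInt (fun x => u * g x) a b = u * RInt g a b).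
  { intros u g Hg. apply (RInt_scal g a b u). now apply ex_RInt_Rcont. }
  destruct k as [k1 k2]. unfold Cmult; simpl. f_equal.
  - rewrite (RInt_minus (V := R_CompleteNormedModule) (fun x => k1 * Re (f x))
       (fun x => k2 * Im (f x))).
    + rewrite !S by assumption. reflexivity.
    + apply ex_RInt_Rcont, Rcont_mult; [apply Rcont_const | assumption].
    + apply ex_RInt_Rcont, Rcont_mult; [apply Rcont_const | assumption].
  - rewrite (RInt_plus (V := R_CompleteNormedModule) (fun x => k1 * Im (f x))
       (fun x => k2 * Re (f x))).
    + rewrite !S by assumption. reflexivity.
    + apply ex_RInt_Rcont, Rcont_mult; [apply Rcont_const | assumption].
    + apply ex_RInt_Rcont, Rcont_mult; [apply Rcont_const | assumption].
Qed.

Lemma CInt_plus (f g : R -> C) (a b : R) : Ccont f -> Ccont g ->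
  CInt (fun x => (f x + g x)%C) a b = (CInt f a b + CInt g a b)%C.
Proof.
  intros Hf Hg. apply (RInt_plus (V := C_R_CompleteNormedModule) f g);
    now apply ex_RInt_Ccont.
Qed.

Lemma CInt_minus (f g : R -> C) (a b : R) : Ccont f -> Ccont g ->
  CInt (fun x => (f x - g x)%C) a b = (CInt f a b - CInt g a b)%C.
Proof.
  intros Hf Hg. apply (RInt_minus (V := C_R_CompleteNormedModule) f g);
    now apply ex_RInt_Ccont.
Qed.

Lemma Cmod_CInt_le (f : R -> C) (g : R -> R) (a b : R) :
  a <= b -> Ccont f -> Rcont g ->
  (forall x, a <= x <= b -> Cmod (f x) <= g x) ->
  Cmod (CInt f a b) <= RInt g a b.
Proof.
  intros Hab Hf Hg H. rewrite <- norm_C_R.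
  apply (norm_RInt_le (V := C_R_NormedModule) f g a b).
  - exact Hab.
  - intros x Hx. rewrite norm_C_R. now apply H.
  - apply (RInt_correct (V := C_R_CompleteNormedModule)). now apply ex_RInt_Ccont.
  - apply (RInt_correct (V := R_CompleteNormedModule)). now apply ex_RInt_Rcont.
Qed.

Lemma CInt_comp (f : R -> C) (g dg : R -> R) (a b : R) :
  Ccont f -> (forall x, is_derive g x (dg x)) -> Rcont dg ->
  CInt (fun x => (dg x * f (g x))%C) a b = CInt f (g a) (g b).
Proof.
  intros Hf Hg Hdg. unfold CInt.
  rewrite <- (RInt_comp (V := C_R_CompleteNormedModule) f g dg a b).
  - apply (RInt_ext (V := C_R_CompleteNormedModule)). intros x _. destruct (f (g x)) as [u v].
    unfold Cmult, RtoC, scal; simpl. unfold prod_scal, scal; simpl; unfold mult; simpl.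
    f_equal; ring.
  - intros x _. apply Hf.
  - intros x _. split; [apply Hg | apply Hdg].
Qed.

Lemma CInt_derive (f df : R -> C) (a b : R) : Ccont df ->
  (forall x, is_derive (fun x => Re (f x)) x (Re (df x))) ->
  (forall x, is_derive (fun x => Im (f x)) x (Im (df x))) ->
  CInt df a b = (f b - f a)%C.
Proof.
  intros Hdf H1 H2. rewrite CInt_components by assumption.
  apply Ccont_components in Hdf as [F1 F2].
  apply injective_projections; simpl;
  apply (is_RInt_unique (V := R_CompleteNormedModule));
  [apply (is_RInt_derive (V := R_CompleteNormedModule) (fun x => Re (f x)))
  |apply (is_RInt_derive (V := R_CompleteNormedModule) (fun x => Im (f x)))]; intros x _;
   [apply H1 | apply F1 | apply H2 | apply F2].
Qed.

Lemma RtoC_neq_0 (r : R) : r <> 0 -> RtoC r <> RtoC 0.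
Proof. intros H E. now apply H, RtoC_inj. Qed.

Lemma exp_le (x y : R) : x <= y -> exp x <= exp y.
Proof. intros [H| ->]; [left; now apply exp_increasing | right; reflexivity]. Qed.

(** * Polar coordinates and the Poisson kernel *)

Lemma CInt_swap (f : R -> C) (a b : R) : Ccont f -> CInt f b a = (- CInt f a b)%C.
Proof.
  intros H. apply eq_sym, (opp_RInt_swap (V := C_R_CompleteNormedModule)).
  now apply ex_RInt_Ccont.
Qed.

(** A translation moves the window to [[- alpha, 2 PI - alpha]], the period carries the overhang
    back, and [t -> 2 PI - t] folds the upper half onto [[0, PI]]. The fold is wanted because
    [theta] below only sweeps out []0, PI[]. *)
Lemma CInt_even_periodic (F : R -> C) (alpha : R) : Ccont F ->
  (forall t, F (t + 2 * PI) = F t) -> (forall t, F (- t) = F t) ->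
  CInt (fun t => F (t - alpha)) 0 (2 * PI) = (2 * CInt F 0 PI)%C.
Proof.
  intros HF Hper Heven.
  assert (H1 : CInt (fun t => F (t - alpha)) 0 (2 * PI) = CInt F (- alpha) (2 * PI - alpha)).
  { replace (- alpha) with (0 - alpha) by ring.
    rewrite <- (CInt_comp F (fun t => t - alpha) (fun _ => 1)).
    - apply CInt_ext. intros x. now rewrite Cmult_1_l.
    - exact HF.
    - intros x. auto_derive; [exact I | ring].
    - apply Rcont_const. }
  assert (H2 : CInt F (2 * PI) (2 * PI - alpha) = CInt F 0 (- alpha)).
  { replace (2 * PI - alpha) with (- alpha + 2 * PI) by ring.
    replace (2 * PI) with (0 + 2 * PI) at 1 by ring.
    rewrite <- (CInt_comp F (fun t => t + 2 * PI) (fun _ => 1)).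
    - apply CInt_ext. intros x. now rewrite Cmult_1_l.
    - exact HF.
    - intros x. auto_derive; [exact I | ring].
    - apply Rcont_const. }
  assert (H3 : CInt F PI (2 * PI) = CInt F 0 PI).
  { replace (CInt F PI (2 * PI)) with (CInt F (2 * PI - PI) (2 * PI - 0)) by (f_equal; ring).
    rewrite <- (CInt_comp F (fun t => 2 * PI - t) (fun _ => -1)).
    - rewrite (CInt_ext _ (fun x => (RtoC (-1) * F x)%C)).
      + rewrite CInt_scal, (CInt_swap F 0 PI) by exact HF. ring.
      + intros x. f_equal. rewrite <- (Heven x), <- (Hper (- x)). f_equal. ring.
    - exact HF.
    - intros x. auto_derive; [exact I | ring].
    - apply Rcont_const. }
  rewrite H1, <- (CInt_Chasles F (- alpha) 0), <- (CInt_Chasles F 0 (2 * PI)) by exact HF.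
  rewrite H2, <- (CInt_Chasles F 0 PI), H3, (CInt_swap F 0 (- alpha)) by exact HF. ring.
Qed.

Lemma polar_form (z : C) : exists alpha, z = (Cmod z * cos alpha, Cmod z * sin alpha).
Proof.
  destruct (Ceq_dec z 0) as [->|Hz].
  { exists 0. rewrite Cmod_0, !Rmult_0_l. reflexivity. }
  apply Cmod_gt_0 in Hz. destruct z as [x y].
  assert (Hm : Cmod (x, y) ^ 2 = x ^ 2 + y ^ 2) by apply Cmod2_alt.
  set (m := Cmod (x, y)) in *.
  set (u := x / m).
  assert (Hu : u ^ 2 + (y / m) ^ 2 = 1).
  { unfold u. replace ((x / m) ^ 2 + (y / m) ^ 2) with ((x ^ 2 + y ^ 2) / m ^ 2) by (field; lra).
    rewrite <- Hm. field. lra. }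
  assert (Hb : -1 <= u <= 1) by (split; nra).
  assert (Hc : cos (acos u) = u) by now apply cos_acos.
  assert (Hs : sin (acos u) = Rabs (y / m)).
  { rewrite <- sqrt_Rsqr_abs, sin_acos by exact Hb. f_equal. unfold Rsqr. lra. }
  assert (Hx : x = m * u) by (unfold u; field; lra).
  destruct (Rle_dec 0 (y / m)) as [H|H].
  - exists (acos u). rewrite Hc, Hs, Rabs_pos_eq by exact H. f_equal; [exact Hx | field; lra].
  - exists (- acos u). rewrite cos_neg, sin_neg, Hc, Hs, Rabs_left by lra.
    f_equal; [exact Hx | field; lra].
Qed.

Definition pois_ang (r t : R) : R := (1 - r ^ 2) / (1 - 2 * r * cos t + r ^ 2).

Lemma pois_den_pos (r t : R) : 0 <= r < 1 -> 0 < 1 - 2 * r * cos t + r ^ 2.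
Proof. intros Hr. generalize (COS_bound t). intros. nra. Qed.

Lemma pois_ang_pos (r t : R) : 0 <= r < 1 -> 0 < pois_ang r t.
Proof.
  intros Hr. apply Rdiv_lt_0_compat; [nra | now apply pois_den_pos].
Qed.

Lemma Rcont_ln_pois_ang (r : R) : 0 <= r < 1 -> Rcont (fun t => ln (pois_ang r t)).
Proof.
  intros Hr. apply Rcont_derive. intros t. unfold pois_ang. auto_derive.
  generalize (pois_den_pos r t Hr) (pois_ang_pos r t Hr). unfold pois_ang, Rdiv. simpl.
  intros H1 H2. split; [lra | split; [exact H2 | exact I]].
Qed.

Lemma poisson_polar (z : C) : exists alpha, forall t : R,
  poisson z (Cexp (Ci * t)%C) = pois_ang (Cmod z) (t - alpha).
Proof.
  destruct (polar_form z) as [alpha Hz]. exists alpha. intros t.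
  unfold poisson, pois_ang. f_equal. rewrite Cmod2_alt.
  set (m := Cmod z) in *. rewrite Hz, cos_minus.
  unfold Cexp; simpl.
  replace (0 * t - 1 * 0) with 0 by ring. rewrite exp_0.
  replace (0 * 0 + 1 * t) with t by ring.
  generalize (sin2_cos2 t) (sin2_cos2 alpha). unfold Rsqr. intros H1 H2.
  replace (_ * _ + _) with ((sin t * sin t + cos t * cos t) - 2 * m * (cos t * cos alpha + sin t * sin alpha)
   + m * m * (sin alpha * sin alpha + cos alpha * cos alpha)) by ring.
  rewrite H1, H2. ring.
Qed.

(** Stated for an arbitrary function of [ln P], so that it serves both branches of [P_poly]. *)
Lemma circle_int_poisson (H : R -> C) (z : C) : Ccont H -> in_disk z ->
  circle_int (fun xi => H (ln (poisson z xi))) =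
  (/ RtoC PI * CInt (fun t => H (ln (pois_ang (Cmod z) t))) 0 PI)%C.
Proof.
  intros HH Hz. unfold circle_int.
  destruct (poisson_polar z) as [alpha Ha].
  change (/ RtoC (2 * PI) * CInt (fun t => H (ln (poisson z (Cexp (Ci * t)%C)))) 0 (2 * PI) =
    / RtoC PI * CInt (fun t => H (ln (pois_ang (Cmod z) t))) 0 PI)%C.
  rewrite (CInt_ext _ (fun t => H (ln (pois_ang (Cmod z) (t - alpha))))).
  - rewrite (CInt_even_periodic (fun t => H (ln (pois_ang (Cmod z) t)))).
    + rewrite RtoC_mult. field. apply RtoC_neq_0, PI_neq0.
    + apply (Ccont_comp _ H); [|exact HH].
      apply Rcont_ln_pois_ang. split; [apply Cmod_ge_0 | exact Hz].
    + intros t. unfold pois_ang. now rewrite cos_plus, cos_2PI, sin_2PI, Rmult_1_r, Rmult_0_r, Rminus_0_r.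
    + intros t. unfold pois_ang. now rewrite cos_neg.
  - intros t. now rewrite Ha.
Qed.

(** A smooth version of [max (0, 2 (x - Rh))]. Since [ln (cosh (Rh - x)) = Rh - x + eta Rh x - ln
    2], kernel and weight become exponentials of linear combinations of [x], [Rh], [eta Rh x] and
    [eta 0 x], and estimates reduce to linear ones on exponents. *)
Definition eta (Rh x : R) : R := ln (1 + exp (2 * (x - Rh))).

(** With [Rh] the hyperbolic distance to [0], the substitution [t = theta Rh x]
    turns the Poisson kernel into [cosh (Rh - x) / cosh x], whose logarithm is
    [Rh + eta Rh x - eta 0 x]. *)
Definition theta (Rh x : R) : R := 2 * atan (exp (x - Rh)).

Definition wt (Rh x : R) : R := 2 * exp (x - Rh) / (1 + exp (2 * (x - Rh))).

Lemma eta_arg_pos (Rh x : R) : 0 < 1 + exp (2 * (x - Rh)).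
Proof. generalize (exp_pos (2 * (x - Rh))); lra. Qed.

Lemma exp_eta (Rh x : R) : exp (eta Rh x) = 1 + exp (2 * (x - Rh)).
Proof. apply exp_ln, eta_arg_pos. Qed.

Lemma Rcont_eta (Rh : R) : Rcont (eta Rh).
Proof.
  apply Rcont_derive. intros x. unfold eta. auto_derive. apply eta_arg_pos.
Qed.

Lemma Rcont_wt (Rh : R) : Rcont (wt Rh).
Proof.
  apply Rcont_derive. intros x. unfold wt. auto_derive.
  apply Rgt_not_eq, eta_arg_pos.
Qed.

Lemma exp_double (y : R) : exp (2 * y) = exp y ^ 2.
Proof. replace (2 * y) with (y + y) by ring. rewrite exp_plus. ring. Qed.

Lemma is_derive_theta (Rh x : R) : is_derive (theta Rh) x (wt Rh x).
Proof.
  unfold theta, wt. auto_derive; [exact I|]. rewrite exp_double.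
  change (x + - Rh) with (x - Rh).
  generalize (exp_pos (x - Rh)). generalize (exp (x - Rh)). intros t Ht. field.
  nra.
Qed.

Lemma cos_2atan (t : R) : cos (2 * atan t) = (1 - t ^ 2) / (1 + t ^ 2).
Proof.
  assert (0 < 1 + t ^ 2) by nra.
  rewrite cos_2a_cos, cos_atan.
  replace (1 + t²) with (1 + t ^ 2) by (unfold Rsqr; ring).
  replace (2 * (1 / sqrt (1 + t ^ 2)) * (1 / sqrt (1 + t ^ 2)) - 1)
    with (2 / (sqrt (1 + t ^ 2) * sqrt (1 + t ^ 2)) - 1).
  - rewrite sqrt_sqrt by lra. field. lra.
  - field. apply Rgt_not_eq, sqrt_lt_R0. lra.
Qed.

(** The tangent of the half angle is [t = e^(x - Rh) = e^x (1 - r) / (1 + r)]. The denominator of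
    the kernel is [((1 - r)^2 + (1 + r)^2 t^2) / (1 + t^2) = (1 - r)^2 (1 + e^(2x)) / (1 + t^2)], so
    the kernel equals [e^Rh (1 + t^2) / (1 + e^(2x))]. *)
Lemma ln_pois_ang_theta (r Rh x : R) : 0 <= r < 1 -> Rh = ln ((1 + r) / (1 - r)) ->
  ln (pois_ang r (theta Rh x)) = Rh + eta Rh x - eta 0 x.
Proof.
  intros Hr HR. rewrite <- (ln_exp (Rh + eta Rh x - eta 0 x)). f_equal.
  unfold Rminus at 1. rewrite !exp_plus, exp_Ropp, !exp_eta.
  assert (HE : exp Rh = (1 + r) / (1 - r)).
  { rewrite HR. apply exp_ln, Rdiv_lt_0_compat; lra. }
  unfold pois_ang, theta. rewrite cos_2atan.
  rewrite !exp_double. rewrite Rminus_0_r.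
  assert (Ht : exp (x - Rh) = exp x * ((1 - r) / (1 + r))).
  { unfold Rminus at 1. rewrite exp_plus, exp_Ropp, HE. field. lra. }
  rewrite Ht, HE.
  generalize (exp_pos x). generalize (exp x). intros X HX.
  assert (0 < X ^ 2) by nra. 
  field. assert (0 <= (X * (1 - r)) ^ 2) by apply pow2_ge_0.
  repeat split; try nra.
  replace (_ + _) with (((1 - r) * (1 + r)) ^ 2 * (1 + X ^ 2)) by ring.
  apply Rmult_integral_contrapositive_currified; [apply pow_nonzero|]; nra.
Qed.

Lemma CInt_pois_theta (H : R -> C) (r Rh a b : R) : Ccont H ->
  0 <= r < 1 -> Rh = ln ((1 + r) / (1 - r)) ->
  CInt (fun t => H (ln (pois_ang r t))) (theta Rh a) (theta Rh b) =
  CInt (fun x => (wt Rh x * H (Rh + eta Rh x - eta 0 x)%R)%C) a b.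
Proof.
  intros HH Hr HR.
  rewrite <- (CInt_comp (fun t => H (ln (pois_ang r t))) (theta Rh) (wt Rh)).
  - apply CInt_ext. intros x. now rewrite (ln_pois_ang_theta r).
  - apply (Ccont_comp _ H); [|exact HH]. now apply Rcont_ln_pois_ang.
  - apply is_derive_theta.
  - apply Rcont_wt.
Qed.

Lemma atan_le (t : R) : 0 < t -> 0 < atan t <= t.
Proof.
  intros Ht. split.
  - rewrite <- atan_0. now apply atan_increasing.
  - destruct (MVT_gen (fun x => x - atan x) 0 t (fun x => 1 - / (1 + x²))) as [c [Hc E]].
    + intros x _. auto_derive; [exact I|]. unfold Rsqr. rewrite Rmult_1_l, Rmult_1_r. reflexivity.
    + intros x _. apply continuity_pt_filterlim.
      apply (ex_derive_continuous (fun x => x - atan x)). auto_derive. exact I.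
    + rewrite atan_0 in E. rewrite Rmin_left, Rmax_right in Hc by lra.
      assert (0 <= (1 - / (1 + c²))).
      { apply Rle_minus_r. rewrite Rplus_0_l, <- Rinv_1. apply Rinv_le_contravar; [lra|].
        generalize (Rle_0_sqr c). lra. }
      nra.
Qed.

Lemma theta_lower (Rh x : R) : 0 < theta Rh x <= 2 * exp (x - Rh).
Proof. unfold theta. generalize (atan_le (exp (x - Rh)) (exp_pos _)). lra. Qed.

Lemma theta_upper (Rh x : R) : 0 < PI - theta Rh x <= 2 * exp (Rh - x).
Proof.
  generalize (atan_le (exp (Rh - x)) (exp_pos _)).
  replace (exp (Rh - x)) with (/ exp (x - Rh)) at 1 2 by (rewrite <- exp_Ropp; f_equal; ring).
  rewrite atan_inv by apply exp_pos. unfold theta. lra.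
Qed.

(** [F] is bounded on [[0, PI]], and the two missing end intervals have lengths at most
    [2 e^(- L - Rh)] and [2 e^(- L + Rh)]. *)
Lemma CInt_theta_lim (F : R -> C) (Rh eps : R) : Ccont F -> 0 < eps ->
  exists L0, forall L, L0 <= L ->
    Cmod (CInt F 0 PI - CInt F (theta Rh (- L)) (theta Rh L))%C <= eps.
Proof.
  intros HF Heps.
  destruct (bounded_continuity (V := C_R_NormedModule) F 0 PI) as [M HM].
  { intros x _. apply HF. }
  assert (HM' : forall x, 0 <= x <= PI -> Cmod (F x) <= M).
  { intros x Hx. rewrite <- norm_C_R. now apply Rlt_le, HM. }
  assert (HM0 : 0 <= M).
  { apply Rle_trans with (Cmod (F 0)); [apply Cmod_ge_0 | apply HM'].
    generalize PI_RGT_0; lra. }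
  assert (B : forall a b, 0 <= a -> a <= b -> b <= PI -> Cmod (CInt F a b) <= M * (b - a)).
  { intros a b Ha Hab Hb. apply Rle_trans with (RInt (fun _ => M) a b).
    - apply Cmod_CInt_le; auto; [apply Rcont_const|].
      intros x Hx. apply HM'. lra.
    - rewrite RInt_const. unfold scal; simpl; unfold mult; simpl. lra. }
  (* [M + 1] instead of [M] keeps [K] positive, as [ln (K / eps)] requires. *)
  set (K := 2 * (M + 1) * (exp (- Rh) + exp Rh)).
  assert (HK : 0 < K).
  { unfold K. generalize (exp_pos (- Rh)) (exp_pos Rh). nra. }
  exists (ln (K / eps)). intros L HL.
  generalize (theta_lower Rh (- L)) (theta_upper Rh L)
     (theta_upper Rh (- L)) (theta_lower Rh L). intros H1 H2 H1' H2'.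

  assert (E : (CInt F 0 PI - CInt F (theta Rh (- L)) (theta Rh L) =
     CInt F 0 (theta Rh (- L)) + CInt F (theta Rh L) PI)%C).
  { rewrite <- (CInt_Chasles F 0 (theta Rh (- L)) PI), 
      <- (CInt_Chasles F (theta Rh (- L)) (theta Rh L) PI) by exact HF. ring. }
  rewrite E. eapply Rle_trans; [apply Cmod_triangle|].
  generalize (B 0 (theta Rh (- L)) ltac:(lra) ltac:(lra) ltac:(lra)).
  generalize (B (theta Rh L) PI ltac:(lra) ltac:(lra) ltac:(lra)).
  intros B1 B2.
  assert (HE : exp (- L) * K <= eps).
  { rewrite exp_Ropp. apply (Rmult_le_reg_l (exp L)); [apply exp_pos|].
    rewrite <- Rmult_assoc, Rinv_r, Rmult_1_l by apply Rgt_not_eq, exp_pos.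
    apply (Rmult_le_reg_r (/ eps)); [now apply Rinv_0_lt_compat|].
    replace (exp L * eps * / eps) with (exp L) by (field; lra).
    rewrite <- (exp_ln (K * / eps)).
    - destruct HL as [HL|HL]; [left; now apply exp_increasing|].
      right; now f_equal.
    - apply Rmult_lt_0_compat; [exact HK | now apply Rinv_0_lt_compat]. }
  unfold K in HE.
  replace (- L - Rh) with (- L + - Rh) in H1 by ring.
  replace (Rh - L) with (- L + Rh) in H2 by ring.
  rewrite exp_plus in H1, H2.
  generalize (exp_pos (- L)) (exp_pos (- Rh)) (exp_pos Rh). intros.
  assert (0 <= exp (- L) * exp (- Rh)) by nra.
  assert (0 <= exp (- L) * exp Rh) by nra.
  nra.
Qed.

(** * Improper integrals with exponentially decaying integrands *)

Lemma exp_decay_small (a k eps : R) : 0 < a -> 0 < k -> 0 < eps ->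
  exists L0, 0 < L0 /\ forall L, L0 <= L -> k * exp (- a * L) <= eps.
Proof.
  intros Ha Hk He. exists (Rmax 1 (ln (k / eps) / a)). split.
  { apply Rlt_le_trans with 1; [lra | apply Rmax_l]. }
  intros L HL. assert (HL' : ln (k / eps) / a <= L) by (eapply Rle_trans; [apply Rmax_r | exact HL]).
  assert (Hq : 0 < k / eps) by (now apply Rdiv_lt_0_compat).
  assert (E : exp (- a * L) <= eps / k).
  { replace (eps / k) with (/ (k / eps)) by (field; lra).
    rewrite <- (exp_ln (k / eps)) by exact Hq. rewrite <- exp_Ropp.
    apply exp_le. apply (Rmult_le_compat_l a) in HL'; [|lra].
    replace (a * (ln (k / eps) / a)) with (ln (k / eps)) in HL' by (field; lra). lra. }
  apply (Rmult_le_compat_l k) in E; [|lra].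
  replace (k * (eps / k)) with eps in E by (field; lra). exact E.
Qed.

Definition is_improper (f : R -> C) (l : C) : Prop :=
  forall eps, 0 < eps -> exists L0, forall L, L0 <= L -> Cmod (CInt f (- L) L - l)%C <= eps.

(** [iota] makes this total in [f], so [J] can be defined without carrying a convergence proof. *)
Definition improper (f : R -> C) : C :=
  iota (T := C_CompleteNormedModule)
    (fun l : C => filterlim (fun L => CInt f (- L) L) (Rbar_locally p_infty)
       (locally (T := C_UniformSpace) l)).

Lemma is_improper_filterlim (f : R -> C) (l : C) :
  is_improper f l <->
  filterlim (fun L => CInt f (- L) L) (Rbar_locally p_infty) (locally (T := C_UniformSpace) l).
Proof.
  rewrite (filterlim_C (Rbar_locally p_infty)). split.
  - intros H eps He. destruct (H (eps / 2)) as [L0 HL]; [lra|]. exists L0. intros L HL1.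
    generalize (HL L (Rlt_le _ _ HL1)). lra.
  - intros H eps He. destruct (H eps He) as [L0 HL]. exists (L0 + 1). intros L HL1.
    apply Rlt_le, HL. lra.
Qed.

Lemma improper_unique (f : R -> C) (l : C) : is_improper f l -> improper f = l.
Proof.
  intros H. apply (iota_filterlim_locally (V := C_CompleteNormedModule)).
  now apply is_improper_filterlim.
Qed.

Definition dominated (a : R) (f : R -> C) : Prop :=
  Ccont f /\ forall x, Cmod (f x) <= 2 * exp (- a * Rabs x).

Lemma dominated_tail (a : R) (f : R -> C) (L L' : R) : 0 < a -> dominated a f ->
  0 <= L <= L' ->
  Cmod (CInt f (- L') L' - CInt f (- L) L)%C <= 4 / a * exp (- a * L).
Proof.
  intros Ha [Hf Hb] HL.
  assert (B1 : Cmod (CInt f L L') <= 2 / a * exp (- a * L)).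
  { apply Rle_trans with (RInt (fun x => 2 * exp (- a * x)) L L').
    - apply Cmod_CInt_le; [lra | exact Hf | | ].
      + apply Rcont_derive. intros x. auto_derive. exact I.
      + intros x Hx. generalize (Hb x). rewrite Rabs_pos_eq by lra. auto.
    - rewrite (is_RInt_unique (V := R_CompleteNormedModule) _ _ _
        (minus (- (2 / a) * exp (- a * L')) (- (2 / a) * exp (- a * L)))).
      + unfold minus, plus, opp; simpl. generalize (exp_pos (- a * L')).
        assert (0 < 2 / a) by (apply Rdiv_lt_0_compat; lra). nra.
      + apply (is_RInt_derive (V := R_CompleteNormedModule) (fun x => - (2 / a) * exp (- a * x))).
        * intros x _. auto_derive; [exact I | field; lra].
        * intros x _. apply Rcont_derive. intros y. auto_derive. exact I. }
  assert (B2 : Cmod (CInt f (- L') (- L)) <= 2 / a * exp (- a * L)).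
  { apply Rle_trans with (RInt (fun x => 2 * exp (a * x)) (- L') (- L)).
    - apply Cmod_CInt_le; [lra | exact Hf | | ].
      + apply Rcont_derive. intros x. auto_derive. exact I.
      + intros x Hx. generalize (Hb x). rewrite Rabs_left1 by lra.
        replace (- a * - x) with (a * x) by ring. auto.
    - rewrite (is_RInt_unique (V := R_CompleteNormedModule) _ _ _
        (minus (2 / a * exp (a * - L)) (2 / a * exp (a * - L')))).
      + unfold minus, plus, opp; simpl. generalize (exp_pos (a * - L')).
        replace (a * - L) with (- a * L) by ring.
        assert (0 < 2 / a) by (apply Rdiv_lt_0_compat; lra). nra.
      + apply (is_RInt_derive (V := R_CompleteNormedModule) (fun x => 2 / a * exp (a * x))).
        * intros x _. auto_derive; [exact I | field; lra].
        * intros x _. apply Rcont_derive. intros y. auto_derive. exact I. }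
  replace (CInt f (- L') L' - CInt f (- L) L)%C with (CInt f (- L') (- L) + CInt f L L')%C.
  - eapply Rle_trans; [apply Cmod_triangle|].
    replace (4 / a * exp (- a * L)) with (2 / a * exp (- a * L) + 2 / a * exp (- a * L)) by (field; lra).
    lra.
  - rewrite <- (CInt_Chasles f (- L') (- L) L'), <- (CInt_Chasles f (- L) L L') by exact Hf. ring.
Qed.

(** The tail bound makes the truncated integrals a Cauchy family in the complete space [C]. *)
Lemma dominated_improper (a : R) (f : R -> C) : 0 < a -> dominated a f ->
  is_improper f (improper f).
Proof.
  intros Ha Hf.
  destruct (proj1 (filterlim_locally_cauchy (U := C_CompleteNormedModule) (F := Rbar_locally p_infty)
     (fun L => CInt f (- L) L))) as [l Hl].
  - intros eps. 
    destruct (exp_decay_small a (4 / a) (eps / 2)) as [L0 [HL0 HL]].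
    { exact Ha. } { apply Rdiv_lt_0_compat; lra. } { generalize (cond_pos eps); lra. }
    exists (fun L => L0 < L). split; [now exists L0|].
    intros u v Hu Hv. apply C_NormedModule_mixin_compat1.
    change (Cmod (CInt f (- v) v - CInt f (- u) u)%C < eps).
    assert (K : forall u v, L0 < u -> u <= v -> Cmod (CInt f (- v) v - CInt f (- u) u)%C < eps).
    { intros u0 v0 H1 H2. eapply Rle_lt_trans; [apply (dominated_tail a); auto; lra|].
      apply Rle_lt_trans with (eps / 2); [apply HL; lra | generalize (cond_pos eps); lra]. }
    destruct (Rle_dec u v).
    + now apply K.
    + rewrite <- Cmod_opp. replace (- _)%C with (CInt f (- u) u - CInt f (- v) v)%C by ring.
      apply K; [exact Hv | lra].
  - assert (Hl' : is_improper f l) by now apply is_improper_filterlim.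
    now rewrite (improper_unique f l Hl').
Qed.

Lemma improper_tail (a : R) (f : R -> C) (l : C) (L : R) : 0 < a -> dominated a f ->
  is_improper f l -> 0 <= L -> Cmod (l - CInt f (- L) L)%C <= 4 / a * exp (- a * L).
Proof.
  intros Ha Hf Hl HL. apply le_epsilon. intros eps He.
  destruct (Hl eps He) as [L0 HL0].
  set (L' := Rmax L L0).
  assert (H1 : L <= L') by apply Rmax_l.
  generalize (HL0 L' (Rmax_r _ _)) (dominated_tail a f L L' Ha Hf (conj HL H1)). intros H2 H3.
  replace (l - CInt f (- L) L)%C with
    ((CInt f (- L') L' - CInt f (- L) L) + - (CInt f (- L') L' - l))%C by ring.
  eapply Rle_trans; [apply Cmod_triangle|]. rewrite Cmod_opp. lra.
Qed.

Lemma dominated_convergence (a : R) (g : R -> R -> C) (ginf : R -> C) (A : R -> C) (J : C) :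
  0 < a -> dominated a ginf -> (forall Rh, 1 <= Rh -> dominated a (g Rh)) ->
  (forall L eps, 0 < L -> 0 < eps -> exists R0, forall Rh x, R0 <= Rh -> Rabs x <= L ->
     Cmod (g Rh x - ginf x)%C <= eps) ->
  is_improper ginf J -> (forall Rh, 1 <= Rh -> is_improper (g Rh) (A Rh)) ->
  forall eps, 0 < eps -> exists R0, forall Rh, R0 <= Rh -> Cmod (A Rh - J)%C <= eps.
Proof.
  intros Ha Hinf Hg Hu HJ HA eps He.
  (* All [g Rh] share one majorant, so the cutoff [L] is chosen before [Rh]. Each of the two tails
     costs [eps / 4]; the bound [eps / (4 * L)] on an interval of length [2 L] costs [eps / 2]. *)
  destruct (exp_decay_small a (4 / a) (eps / 4)) as [L [HL0 HL]].
  { exact Ha. } { apply Rdiv_lt_0_compat; lra. } { lra. }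
  specialize (HL L (Rle_refl _)).
  destruct (Hu L (eps / (4 * L))) as [R0 HR0].
  { exact HL0. } { apply Rdiv_lt_0_compat; lra. }
  exists (Rmax 1 R0). intros Rh HRh.
  assert (H1 : 1 <= Rh) by (eapply Rle_trans; [apply Rmax_l | exact HRh]).
  assert (H2 : R0 <= Rh) by (eapply Rle_trans; [apply Rmax_r | exact HRh]).
  generalize (improper_tail a (g Rh) (A Rh) L Ha (Hg Rh H1) (HA Rh H1) (Rlt_le _ _ HL0)).
  generalize (improper_tail a ginf J L Ha Hinf HJ (Rlt_le _ _ HL0)).
  intros T1 T2.
  assert (T3 : Cmod (CInt (g Rh) (- L) L - CInt ginf (- L) L)%C <= eps / 2).
  { rewrite <- CInt_minus by (apply Hg || apply Hinf; assumption).
    apply Rle_trans with (RInt (fun _ => eps / (4 * L)) (- L) L).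
    - apply Cmod_CInt_le; [lra | | apply Rcont_const | ].
      + apply Ccont_minus; [now apply Hg | apply Hinf].
      + intros x Hx. apply HR0; [exact H2 | apply Rabs_le; lra].
    - rewrite RInt_const. unfold scal; simpl; unfold mult; simpl. right. field. lra. }
  replace (A Rh - J)%C with ((A Rh - CInt (g Rh) (- L) L) + (CInt (g Rh) (- L) L - CInt ginf (- L) L)
    + - (J - CInt ginf (- L) L))%C by ring.
  eapply Rle_trans; [apply Cmod_triangle|]. rewrite Cmod_opp.
  eapply Rle_trans; [apply Rplus_le_compat_r, Cmod_triangle|]. lra.
Qed.

(** * The limit for lambda off the half-line *)

Lemma Cmod_Cexp (z : C) : Cmod (Cexp z) = exp (Re z).
Proof.
  unfold Cexp, Cmod; simpl fst; simpl snd. generalize (exp_pos (Re z)). intros.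
  replace (_ + _) with (exp (Re z) * exp (Re z)).
  - apply sqrt_square. lra.
  - generalize (sin2_cos2 (Im z)). unfold Rsqr. intros E.
    replace ((exp (Re z) * cos (Im z)) ^ 2 + (exp (Re z) * sin (Im z)) ^ 2) with
     (exp (Re z) * exp (Re z) * (sin (Im z) * sin (Im z) + cos (Im z) * cos (Im z))) by ring.
    rewrite E. ring.
Qed.

Lemma C_half : (1 / 2)%C = RtoC (1 / 2).
Proof. rewrite RtoC_div; [reflexivity | lra]. Qed.

Lemma Cexp_plus (z w : C) : Cexp (z + w)%C = (Cexp z * Cexp w)%C.
Proof.
  unfold Cexp, Cmult; simpl. unfold Re, Im. rewrite exp_plus, cos_plus, sin_plus.
  f_equal; ring.
Qed.

Lemma Cexp_RtoC (x : R) : Cexp (RtoC x) = RtoC (exp x).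
Proof. unfold Cexp, RtoC; simpl. rewrite cos_0, sin_0. f_equal; ring. Qed.

Lemma Cexp_neq_0 (z : C) : Cexp z <> 0.
Proof. apply Cmod_gt_0. rewrite Cmod_Cexp. apply exp_pos. Qed.

Lemma eta_pos (Rh x : R) : 0 < eta Rh x.
Proof.
  unfold eta. rewrite <- ln_1. apply ln_increasing; [lra|].
  generalize (exp_pos (2 * (x - Rh))). lra.
Qed.

Lemma eta_le_exp (Rh x : R) : eta Rh x <= exp (2 * (x - Rh)).
Proof.
  unfold eta. rewrite <- (ln_exp (exp (2 * (x - Rh)))) at 2.
  apply ln_le; [apply eta_arg_pos | apply exp_ineq1_le].
Qed.

Lemma eta_ge (Rh x : R) : 2 * (x - Rh) <= eta Rh x.
Proof.
  unfold eta. rewrite <- (ln_exp (2 * (x - Rh))) at 1.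
  apply ln_le; [apply exp_pos | lra].
Qed.

(** Together with [eta_0_le] this gives [|log P| <= Rh], the Harnack bounds for the Poisson
    kernel. *)
Lemma eta_le_0 (Rh x : R) : 0 <= Rh -> eta Rh x <= eta 0 x.
Proof.
  intros H. apply ln_le; [apply eta_arg_pos|].
  apply Rplus_le_compat_l, exp_le. lra.
Qed.

Lemma eta_0_le (Rh x : R) : 0 <= Rh -> eta 0 x <= eta Rh x + 2 * Rh.
Proof.
  intros H. rewrite <- (ln_exp (eta Rh x + 2 * Rh)).
  apply ln_le; [apply eta_arg_pos|]. rewrite exp_plus, exp_eta, Rmult_plus_distr_r, <- exp_plus.
  replace (2 * (x - Rh) + 2 * Rh) with (2 * (x - 0)) by ring.
  generalize (exp_le 0 (2 * Rh)). rewrite exp_0. lra.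
Qed.

Lemma wt_eta (Rh x : R) : wt Rh x = 2 * exp (x - Rh - eta Rh x).
Proof.
  unfold wt, Rdiv. rewrite <- exp_eta, Rmult_assoc, <- exp_Ropp, <- exp_plus. reflexivity.
Qed.

Definition kern (w : C) (x : R) : C :=
  (RtoC (2 * exp x) * Cexp (- (w + 1 / 2) * eta 0 x))%C.

(** The integrand of [pois_integral_lim] after the substitution [theta],
    divided by [Rh ^ n * exp ((w - 1/2) Rh)]. *)
Definition kernR (n : nat) (w : C) (Rh x : R) : C :=
  (kern w x * (RtoC ((1 + (eta Rh x - eta 0 x) / Rh) ^ n) *
     Cexp ((w - 1 / 2) * eta Rh x)))%C.

Lemma Ccont_kern (w : C) : Ccont (kern w).
Proof.
  apply Ccont_mult.
  - apply Ccont_RtoC, Rcont_derive. intros x. auto_derive. exact I.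
  - apply Ccont_Cexp, Rcont_eta.
Qed.

Lemma Ccont_kernR (n : nat) (w : C) (Rh : R) : Ccont (kernR n w Rh).
Proof.
  apply Ccont_mult; [apply Ccont_kern|]. apply Ccont_mult.
  - apply Ccont_RtoC, Rcont_pow, Rcont_plus; [apply Rcont_const|].
    apply Rcont_mult; [|apply Rcont_const]. apply Rcont_minus; apply Rcont_eta.
  - apply Ccont_Cexp, Rcont_eta.
Qed.

Lemma Cmod_kern (w : C) (x : R) :
  Cmod (kern w x) = 2 * exp (x - (Re w + 1 / 2) * eta 0 x).
Proof.
  unfold kern. rewrite Cmod_mult, Cmod_Cexp, Cmod_R, Rabs_pos_eq.
  - unfold Rminus. rewrite exp_plus, Rmult_assoc. do 3 f_equal. rewrite C_half. simpl. unfold Re. ring.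
  - generalize (exp_pos x); lra.
Qed.

(** For [x < 0], [eta 0 x > 0] bounds the exponent by [x]; for [x >= 0], [eta 0 x >= 2 x] bounds it
    by [- 2 (Re w) x]. The decay rate is the smaller of the two. *)
Lemma dominated_kern (w : C) : 0 < Re w -> dominated (Rmin 1 (2 * Re w)) (kern w).
Proof.
  intros Hw. split; [apply Ccont_kern|]. intros x. rewrite Cmod_kern.
  apply Rmult_le_compat_l; [lra|]. apply exp_le.
  generalize (Rmin_l 1 (2 * Re w)) (Rmin_r 1 (2 * Re w)) (eta_pos 0 x) (eta_ge 0 x). intros.
  destruct (Rle_dec 0 x).
  - rewrite Rabs_pos_eq by assumption. nra.
  - rewrite Rabs_left by lra. nra.
Qed.

Lemma dominated_kernR (n : nat) (w : C) (Rh : R) : 0 < Re w -> 0 < Rh ->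
  dominated (Rmin 1 (2 * Re w)) (kernR n w Rh).
Proof.
  intros Hw HR. split; [apply Ccont_kernR|]. intros x.
  unfold kernR. rewrite !Cmod_mult, Cmod_kern, Cmod_Cexp, Cmod_R, <- RPow_abs.
  replace (Re ((w - 1 / 2) * eta Rh x)%C) with ((Re w - 1 / 2) * eta Rh x) by (rewrite C_half; unfold Re; simpl; ring).
  generalize (eta_le_0 Rh x (Rlt_le _ _ HR)) (eta_0_le Rh x (Rlt_le _ _ HR)) (eta_pos Rh x). intros E1 E2 E3.
  (* The base of the power is [log P / Rh]. *)
  assert (Hp : Rabs (1 + (eta Rh x - eta 0 x) / Rh) ^ n <= 1).
  { apply Rle_trans with (1 ^ n); [|right; apply pow1]. apply pow_incr. split; [apply Rabs_pos|]. apply Rabs_le.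
    replace (1 + (eta Rh x - eta 0 x) / Rh) with ((Rh + (eta Rh x - eta 0 x)) / Rh) by (field; lra).
    split; apply (Rmult_le_reg_r Rh); try lra;
      unfold Rdiv; rewrite Rmult_assoc, Rinv_l by lra; lra. }
  apply Rle_trans with (2 * exp (x - (Re w + 1 / 2) * eta 0 x) * exp ((Re w - 1 / 2) * eta Rh x)).
  { apply Rmult_le_compat_l; [generalize (exp_pos (x - (Re w + 1 / 2) * eta 0 x)); lra|].
    generalize (exp_pos ((Re w - 1 / 2) * eta Rh x)). nra. }
  rewrite Rmult_assoc, <- exp_plus. apply Rmult_le_compat_l; [lra|]. apply exp_le.
  generalize (Rmin_l 1 (2 * Re w)) (Rmin_r 1 (2 * Re w)) (eta_pos 0 x) (eta_ge 0 x). intros.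
  destruct (Rle_dec 0 x).
  (* For [Re w <= 1/2] the term [(Re w - 1/2) * eta Rh x] is at most zero and the bound for [kern]
     applies. Otherwise [eta Rh x <= eta 0 x] leaves the exponent [x - eta 0 x <= - |x|]. *)
  - rewrite Rabs_pos_eq by assumption. destruct (Rle_dec (Re w) (1 / 2)); nra.
  - rewrite Rabs_left by lra. destruct (Rle_dec (Re w) (1 / 2)); nra.
Qed.

Lemma factor_near_1 (n : nat) (v : C) (eps : R) : 0 < eps ->
  exists tau, 0 < tau /\ forall a b, Rabs a <= tau -> Rabs b <= tau ->
    Cmod (RtoC ((1 + a) ^ n) * Cexp (v * b) - 1)%C <= eps.
Proof.
  intros He.
  assert (K1 : continuous (fun a : R => (1 + a) ^ n) 0).
  { apply (ex_derive_continuous (fun a : R => (1 + a) ^ n)). auto_derive. exact I. }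
  assert (K2 : filterlim (fun b : R => Cexp (v * b)%C) (locally 0) (locally (T := C_UniformSpace) (RtoC 1))).
  { replace (RtoC 1) with (Cexp (v * RtoC 0)%C).
    - apply (Ccont_Cexp v (fun b => b)). intros x. apply continuous_id.
    - rewrite Cmult_0_r, Cexp_RtoC, exp_0. reflexivity. }
  (* If the factors deviate from 1 by [u] and [v], the product deviates by [u v + u + v], which is
     at most [3 e] once [e <= 1]. *)
  set (e := Rmin 1 (eps / 3)).
  assert (He' : 0 < e) by (apply Rmin_pos; lra).
  assert (He1 : e <= 1) by apply Rmin_l. assert (He2 : e <= eps / 3) by apply Rmin_r.
  destruct (proj1 (filterlim_C _ _ _) K2 e He') as [d2 H2].
  destruct (proj1 (filterlim_locally _ _) K1 (mkposreal e He')) as [d1 H1].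
  exists (Rmin d1 d2 / 2).
  assert (Hd : 0 < Rmin d1 d2) by (apply Rmin_pos; apply cond_pos).
  generalize (Rmin_l d1 d2) (Rmin_r d1 d2). intros D1 D2.
  split; [lra|]. intros a b Ha Hb.
  assert (B1 : Rabs ((1 + a) ^ n - 1) < e).
  { specialize (H1 a). rewrite Rplus_0_r, pow1 in H1. apply H1.
    change (Rabs (a - 0) < d1). rewrite Rminus_0_r. lra. }
  assert (B2 : Cmod (Cexp (v * b) - 1)%C < e).
  { apply H2. change (Rabs (b - 0) < d2). rewrite Rminus_0_r. lra. }
  replace (RtoC ((1 + a) ^ n) * Cexp (v * b) - 1)%C with
    (RtoC ((1 + a) ^ n - 1) * (Cexp (v * b) - 1) + (RtoC ((1 + a) ^ n - 1) + (Cexp (v * b) - 1)))%C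
    by (rewrite RtoC_minus; ring).
  eapply Rle_trans; [apply Cmod_triangle|].
  eapply Rle_trans; [apply Rplus_le_compat_l, Cmod_triangle|].
  rewrite Cmod_mult, Cmod_R.
  generalize (Rabs_pos ((1 + a) ^ n - 1)) (Cmod_ge_0 (Cexp (v * b) - 1)%C). nra.
Qed.

(** For [|x| <= L] and [D = e^(2L)], one has [eta 0 x <= D] and [eta Rh x <= D e^(- 2 Rh)]. Hence
    the correction to the power is at most [D / Rh], the argument of [Cexp] tends to 0, and
    [|kern| <= 2] turns [eps / 2] into [eps]. *)
Lemma kernR_uniform (n : nat) (w : C) (L eps : R) : 0 < Re w -> 0 < L -> 0 < eps ->
  exists R0, forall Rh x, R0 <= Rh -> Rabs x <= L ->
    Cmod (kernR n w Rh x - kern w x)%C <= eps.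
Proof.
  intros Hw HL He.
  destruct (factor_near_1 n (w - 1 / 2)%C (eps / 2)) as [tau [Ht Hf]]; [lra|].
  set (D := exp (2 * L)).
  assert (HD : 0 < D) by apply exp_pos.
  destruct (exp_decay_small 2 D tau) as [R1 [HR1 HE]]; try lra.
  exists (Rmax R1 (D / tau)). intros Rh x HR Hx.
  assert (HRa : R1 <= Rh) by (eapply Rle_trans; [apply Rmax_l | exact HR]).
  assert (HRb : D / tau <= Rh) by (eapply Rle_trans; [apply Rmax_r | exact HR]).
  apply Rabs_le_between in Hx.
  assert (Hk : Cmod (kern w x) <= 2).
  { rewrite Cmod_kern.
    assert (B : x - (Re w + 1 / 2) * eta 0 x <= 0) by (generalize (eta_pos 0 x) (eta_ge 0 x); nra).
    apply exp_le in B. rewrite exp_0 in B. lra. }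
  unfold kernR.
  replace (_ - _)%C with (kern w x * (RtoC ((1 + (eta Rh x - eta 0 x) / Rh) ^ n) *
     Cexp ((w - 1 / 2) * eta Rh x) - 1))%C by ring.
  rewrite Cmod_mult.
  assert (B : Cmod (RtoC ((1 + (eta Rh x - eta 0 x) / Rh) ^ n) *
     Cexp ((w - 1 / 2) * eta Rh x) - 1)%C <= eps / 2).
  { apply Hf.
    - unfold Rdiv. rewrite Rabs_mult, Rabs_inv, (Rabs_pos_eq Rh) by lra.
      apply (Rmult_le_reg_r Rh); [lra|]. rewrite Rmult_assoc, Rinv_l, Rmult_1_r by lra.
      assert (D <= tau * Rh).
      { apply (Rmult_le_compat_l tau) in HRb; [|lra]. replace (tau * (D / tau)) with D in HRb by (field; lra). exact HRb. }
      apply Rle_trans with D; [|assumption].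
      apply Rle_trans with (eta 0 x).
      + apply Rabs_le. generalize (eta_pos Rh x) (eta_pos 0 x) (eta_le_0 Rh x ltac:(lra)). lra.
      + eapply Rle_trans; [apply eta_le_exp|]. apply exp_le. lra.
    - rewrite Rabs_pos_eq by (apply Rlt_le, eta_pos).
      eapply Rle_trans; [apply eta_le_exp|]. eapply Rle_trans; [|apply (HE Rh HRa)].
      unfold D. rewrite <- exp_plus. apply exp_le. lra. }
  generalize (Cmod_ge_0 (kern w x)) (Cmod_ge_0 (RtoC ((1 + (eta Rh x - eta 0 x) / Rh) ^ n) *
     Cexp ((w - 1 / 2) * eta Rh x) - 1)%C). nra.
Qed.

(** The exponents [x - Rh - eta Rh x] of the weight and [(w + 1/2) (Rh + eta Rh x - eta 0 x)] of the
    kernel regroup as [(w - 1/2) Rh], the exponent of [kern], and [(w - 1/2) eta Rh x]. *)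
Lemma wt_power_eq (n : nat) (w : C) (Rh x : R) : 0 < Rh ->
  (RtoC (wt Rh x) * (RtoC ((Rh + eta Rh x - eta 0 x) ^ n) *
     Cexp ((w + 1 / 2) * (Rh + eta Rh x - eta 0 x)%R)) =
   (RtoC (Rh ^ n) * Cexp ((w - 1 / 2) * Rh)) * kernR n w Rh x)%C.
Proof.
  intros HR. unfold kernR, kern.
  replace (Rh + eta Rh x - eta 0 x) with (Rh * (1 + (eta Rh x - eta 0 x) / Rh)) at 1 by (field; lra).
  rewrite Rpow_mult_distr, RtoC_mult, wt_eta, !(RtoC_mult 2), <- !Cexp_RtoC.
  set (U := RtoC ((1 + (eta Rh x - eta 0 x) / Rh) ^ n)).
  transitivity (2 * RtoC (Rh ^ n) * U * (Cexp (RtoC (x - Rh - eta Rh x)) * Cexp ((w + 1 / 2) * (Rh + eta Rh x - eta 0 x)%R)))%C; [ring|].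
  transitivity (2 * RtoC (Rh ^ n) * U * (Cexp ((w - 1 / 2) * Rh) * Cexp (RtoC x) * Cexp (- (w + 1 / 2) * eta 0 x)
     * Cexp ((w - 1 / 2) * eta Rh x)))%C; [|ring].
  rewrite <- !Cexp_plus. do 2 f_equal.
  rewrite !RtoC_minus, RtoC_plus. field.
Qed.

(** [J w] is the integral of [2 e^x (1 + e^(2x))^(-w-1/2)] over the line, that is
    [B (1/2, w)]. *)
Definition J (w : C) : C := improper (kern w).

Lemma is_improper_J (w : C) : 0 < Re w -> is_improper (kern w) (J w).
Proof.
  intros Hw. apply (dominated_improper (Rmin 1 (2 * Re w))).
  - apply Rmin_pos; lra.
  - now apply dominated_kern.
Qed.

Lemma pois_integral_lim (n : nat) (w : C) (eps : R) : 0 < Re w -> 0 < eps ->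
  exists R0, forall r Rh, 0 <= r < 1 -> Rh = ln ((1 + r) / (1 - r)) -> R0 <= Rh ->
    exists A, Cmod (A - J w)%C <= eps /\
    CInt (fun t => RtoC (ln (pois_ang r t) ^ n) * Cexp ((w + 1 / 2) * ln (pois_ang r t)))%C 0 PI =
    (RtoC (Rh ^ n) * Cexp ((w - 1 / 2) * Rh) * A)%C.
Proof.
  intros Hw He.
  assert (Ha : 0 < Rmin 1 (2 * Re w)) by (apply Rmin_pos; lra).
  destruct (dominated_convergence (Rmin 1 (2 * Re w)) (kernR n w) (kern w)
     (fun Rh => improper (kernR n w Rh)) (J w)) with (eps := eps) as [R0 HR0].
  - exact Ha.
  - now apply dominated_kern.
  - intros Rh HR. apply dominated_kernR; lra.
  - intros L e HL H. now apply kernR_uniform.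
  - now apply is_improper_J.
  - intros Rh HR. apply (dominated_improper (Rmin 1 (2 * Re w))); [exact Ha|].
    apply dominated_kernR; lra.
  - exact He.
  - exists (Rmax 1 R0). intros r Rh Hr HRh HR.
    assert (H1 : 1 <= Rh) by (eapply Rle_trans; [apply Rmax_l | exact HR]).
    assert (H2 : R0 <= Rh) by (eapply Rle_trans; [apply Rmax_r | exact HR]).
    set (F := fun t : R => (RtoC (ln (pois_ang r t) ^ n) * Cexp ((w + 1 / 2) * ln (pois_ang r t)))%C).
    set (N := (RtoC (Rh ^ n) * Cexp ((w - 1 / 2) * Rh))%C).
    assert (HN : N <> 0).
    { apply Cmult_neq_0; [apply RtoC_neq_0, pow_nonzero; lra | apply Cexp_neq_0]. }
    assert (HFH : Ccont (fun y : R => RtoC (y ^ n) * Cexp ((w + 1 / 2) * y))%C).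
    { apply Ccont_mult.
      - apply Ccont_RtoC, Rcont_pow. intros y. apply continuous_id.
      - apply (Ccont_Cexp _ (fun y => y)). intros y. apply continuous_id. }
    assert (HF : Ccont F).
    { apply (Ccont_comp _ (fun y : R => RtoC (y ^ n) * Cexp ((w + 1 / 2) * y))%C); [|exact HFH].
      now apply Rcont_ln_pois_ang. }
    (* This makes the required equality exact. Since [theta Rh] exhausts []0, PI[], the quotient is
       also the improper integral of [kernR n w Rh], to which dominated convergence applies. *)
    exists (CInt F 0 PI / N)%C. split; [|field; exact HN].
    assert (HI : is_improper (kernR n w Rh) (CInt F 0 PI / N)%C).
    { intros e Hee.
      assert (HmN : 0 < Cmod N) by now apply Cmod_gt_0.
      destruct (CInt_theta_lim F Rh (e * Cmod N) HF) as [L0 HL0]; [now apply Rmult_lt_0_compat|].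
      exists L0. intros L HL. specialize (HL0 L HL).
      assert (E : CInt F (theta Rh (- L)) (theta Rh L) = (N * CInt (kernR n w Rh) (- L) L)%C).
      { unfold F.
        rewrite (CInt_pois_theta (fun y : R => RtoC (y ^ n) * Cexp ((w + 1 / 2) * y))%C r Rh) by assumption.
        rewrite <- CInt_scal by apply Ccont_kernR.
        apply CInt_ext. intros x. apply wt_power_eq. lra. }
      rewrite E in HL0. apply (Rmult_le_reg_r (Cmod N)); [exact HmN|].
      rewrite <- Cmod_mult, <- Cmod_opp.
      replace (- _)%C with (CInt F 0 PI - N * CInt (kernR n w Rh) (- L) L)%C by (field; exact HN).
      exact HL0. }
    rewrite <- (improper_unique _ _ HI). now apply HR0.
Qed.

(** * Non-vanishing of the constant *)

Lemma is_improper_plus (f g : R -> C) (l m : C) : Ccont f -> Ccont g ->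
  is_improper f l -> is_improper g m -> is_improper (fun x => (f x + g x)%C) (l + m)%C.
Proof.
  intros Hf Hg Hl Hm eps He.
  destruct (Hl (eps / 2)) as [L1 H1]; [lra|]. destruct (Hm (eps / 2)) as [L2 H2]; [lra|].
  exists (Rmax L1 L2). intros L HL.
  specialize (H1 L (Rle_trans _ _ _ (Rmax_l _ _) HL)).
  specialize (H2 L (Rle_trans _ _ _ (Rmax_r _ _) HL)).
  rewrite CInt_plus by assumption.
  replace (_ - _)%C with ((CInt f (- L) L - l) + (CInt g (- L) L - m))%C by ring.
  eapply Rle_trans; [apply Cmod_triangle | lra].
Qed.

Lemma is_improper_scal (k : C) (f : R -> C) (l : C) : Ccont f ->
  is_improper f l -> is_improper (fun x => (k * f x)%C) (k * l)%C.
Proof.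
  intros Hf Hl eps He.
  assert (Hk : 0 < Cmod k + 1) by (generalize (Cmod_ge_0 k); lra).
  destruct (Hl (eps / (Cmod k + 1))) as [L1 H1]; [now apply Rdiv_lt_0_compat|].
  exists L1. intros L HL. specialize (H1 L HL). rewrite CInt_scal by assumption.
  replace (_ - _)%C with (k * (CInt f (- L) L - l))%C by ring.
  rewrite Cmod_mult. apply (Rmult_le_compat_l (Cmod k + 1)) in H1; [|lra].
  replace ((Cmod k + 1) * (eps / (Cmod k + 1))) with eps in H1 by (field; lra).
  generalize (Cmod_ge_0 (CInt f (- L) L - l)%C). lra.
Qed.

Lemma is_improper_derive (a : R) (f df : R -> C) : 0 < a -> dominated a f -> Ccont df ->
  (forall x, is_derive (fun x => Re (f x)) x (Re (df x))) ->
  (forall x, is_derive (fun x => Im (f x)) x (Im (df x))) ->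
  is_improper df 0.
Proof.
  intros Ha [_ Hb] Hdf H1 H2 eps He.
  destruct (exp_decay_small a 4 eps) as [L0 [HL0 HL]]; try lra.
  exists L0. intros L HL1. rewrite (CInt_derive f) by assumption.
  replace (_ - _)%C with (f L + - f (- L)%R)%C by ring.
  eapply Rle_trans; [apply Cmod_triangle|]. rewrite Cmod_opp.
  generalize (Hb L) (Hb (- L)) (HL L HL1). rewrite Rabs_Ropp, Rabs_pos_eq by lra. lra.
Qed.

(** Written through [exp (- eta 0 x)] because multiplying [kern w] by that factor gives
    [kern (w + 1)]. *)
Lemma is_derive_eta (x : R) : is_derive (eta 0) x (2 * (1 - exp (- eta 0 x))).
Proof.
  unfold eta at 1. auto_derive; [apply eta_arg_pos|].
  rewrite exp_Ropp, exp_eta. change (x + - 0) with (x - 0).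
  generalize (exp_pos (2 * (x - 0))). intros. field. lra.
Qed.

Lemma kern_succ (w : C) (x : R) : kern (w + 1) x = (kern w x * RtoC (exp (- eta 0 x)))%C.
Proof.
  unfold kern. rewrite <- Cexp_RtoC, <- Cmult_assoc, <- Cexp_plus. do 2 f_equal.
  rewrite RtoC_opp. ring.
Qed.

Lemma kern_polar (w : C) (x : R) :
  kern w x = (2 * exp (x - (Re w + 1 / 2) * eta 0 x) * cos (Im w * eta 0 x),
              - (2 * exp (x - (Re w + 1 / 2) * eta 0 x) * sin (Im w * eta 0 x))).
Proof.
  unfold kern. rewrite C_half. unfold Rminus. rewrite exp_plus. unfold Cexp. simpl. unfold Re, Im.
  replace (- (fst w + 1 / 2) * eta 0 x - - (snd w + 0) * 0) with (- ((fst w + 1 / 2) * eta 0 x)) by ring.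
  replace (- (fst w + 1 / 2) * 0 + - (snd w + 0) * eta 0 x) with (- (snd w * eta 0 x)) by ring.
  rewrite cos_neg, sin_neg. unfold Cmult; simpl. f_equal; ring.
Qed.

Lemma is_derive_exp_trig (h : R -> R) (a b x dh : R) : is_derive h x dh ->
  is_derive (fun y => 2 * exp (y - a * h y) * cos (b * h y)) x
    (2 * exp (x - a * h x) * ((1 - a * dh) * cos (b * h x) - b * dh * sin (b * h x))) /\
  is_derive (fun y => - (2 * exp (y - a * h y) * sin (b * h y))) x
    (- (2 * exp (x - a * h x) * ((1 - a * dh) * sin (b * h x) + b * dh * cos (b * h x)))).
Proof.
  intros H. assert (ex_derive h x) by now exists dh.
  split; (auto_derive; [tauto|]);
    replace (Derive _ x) with dh by (symmetry; now apply is_derive_unique); unfold Rminus; ring.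
Qed.

(** The recurrence of the Beta function. The logarithmic derivative of [kern w] is [1 - (2 w + 1) (1
    - e^(- eta)) = - 2 w + (2 w + 1) e^(- eta)], and the integral of the derivative over the line
    vanishes. *)
Lemma J_rec (w : C) : 0 < Re w -> (2 * w * J w = (2 * w + 1) * J (w + 1))%C.
Proof.
  intros Hw. assert (Hw1 : 0 < Re (w + 1)%C) by (simpl; unfold Re in Hw; lra).
  (* [df] is the derivative of [kern w]. *)
  set (df := fun x => ((- (2 * w)) * kern w x + (2 * w + 1) * kern (w + 1) x)%C).
  assert (Hdf : Ccont df).
  { apply Ccont_plus; (apply Ccont_mult; [apply Ccont_const | apply Ccont_kern]). }
  assert (E1 : is_improper df ((- (2 * w)) * J w + (2 * w + 1) * J (w + 1))%C).
  { apply is_improper_plus.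
    - apply Ccont_mult; [apply Ccont_const | apply Ccont_kern].
    - apply Ccont_mult; [apply Ccont_const | apply Ccont_kern].
    - apply is_improper_scal; [apply Ccont_kern | now apply is_improper_J].
    - apply is_improper_scal; [apply Ccont_kern | now apply is_improper_J]. }
  assert (E2 : is_improper df 0).
  { apply (is_improper_derive (Rmin 1 (2 * Re w)) (kern w)).
    - apply Rmin_pos; lra.
    - now apply dominated_kern.
    - exact Hdf.
    - intros x. apply is_derive_ext with (fun x => 2 * exp (x - (Re w + 1 / 2) * eta 0 x) * cos (Im w * eta 0 x)).
      { intros y. now rewrite kern_polar. }
      replace (Re (df x)) with (2 * exp (x - (Re w + 1 / 2) * eta 0 x) *
        ((1 - (Re w + 1 / 2) * (2 * (1 - exp (- eta 0 x)))) * cos (Im w * eta 0 x)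
          - Im w * (2 * (1 - exp (- eta 0 x))) * sin (Im w * eta 0 x))).
      + apply (is_derive_exp_trig (eta 0)), is_derive_eta.
      + unfold df. rewrite kern_succ, kern_polar. simpl. unfold Re, Im. field.
    - intros x. apply is_derive_ext with (fun x => - (2 * exp (x - (Re w + 1 / 2) * eta 0 x) * sin (Im w * eta 0 x))).
      { intros y. now rewrite kern_polar. }
      replace (Im (df x)) with (- (2 * exp (x - (Re w + 1 / 2) * eta 0 x) *
        ((1 - (Re w + 1 / 2) * (2 * (1 - exp (- eta 0 x)))) * sin (Im w * eta 0 x)
          + Im w * (2 * (1 - exp (- eta 0 x))) * cos (Im w * eta 0 x)))).
      + apply (is_derive_exp_trig (eta 0)), is_derive_eta.
      + unfold df. rewrite kern_succ, kern_polar. simpl. unfold Re, Im. field. }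
  apply improper_unique in E1, E2. rewrite E1 in E2.
  transitivity (2 * w * J w + (- (2 * w) * J w + (2 * w + 1) * J (w + 1)))%C.
  - rewrite E2. ring.
  - ring.
Qed.

(** For [0 <= y < 2], [1 - cos y = 2 sin^2 (y / 2) <= y^2 / 2 <= y]; for [y >= 2] the left side is
    at most [-1]. *)
Lemma cos_ge (x : R) : 1 - Rabs x <= cos x.
Proof.
  assert (H : forall y, 0 <= y -> 1 - y <= cos y).
  { intros y Hy. destruct (Rle_dec 2 y).
    - generalize (COS_bound y). lra.
    - replace y with (2 * (y / 2)) at 2 by field. rewrite cos_2a_sin.
      assert (sin (y / 2) <= y / 2).
      { destruct Hy as [Hy| <-]; [apply Rlt_le, sin_lt_x; lra | right; rewrite Rdiv_0_l; apply sin_0]. }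
      assert (0 <= sin (y / 2)).
      { apply sin_ge_0; generalize PI2_1; lra. }
      nra. }
  destruct (Rle_dec 0 x).
  - rewrite Rabs_pos_eq by assumption. now apply H.
  - rewrite Rabs_left, <- cos_neg by lra. apply H. lra.
Qed.

Definition kern_real (sigma x : R) : R := 2 * exp (x - (sigma + 1 / 2) * eta 0 x).

Lemma Rcont_kern_real (sigma : R) : Rcont (kern_real sigma).
Proof.
  apply Rcont_mult; [apply Rcont_const|].
  apply (Rcont_comp _ exp).
  - apply Rcont_minus; [intros x; apply continuous_id|].
    apply Rcont_mult; [apply Rcont_const | apply Rcont_eta].
  - apply Rcont_derive. intros x. auto_derive. exact I.
Qed.

Lemma kern_RtoC (sigma x : R) : kern (RtoC sigma) x = RtoC (kern_real sigma x).
Proof.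
  unfold kern, kern_real, Rminus. rewrite C_half, exp_plus, <- Rmult_assoc, (RtoC_mult (2 * exp x)).
  f_equal. rewrite <- Cexp_RtoC. f_equal. rewrite RtoC_opp, RtoC_mult, RtoC_plus. ring.
Qed.

Lemma Re_le_lim (f : R -> C) (l : C) (m L1 : R) : is_improper f l ->
  (forall L, L1 <= L -> m <= Re (CInt f (- L) L)) -> m <= Re l.
Proof.
  intros Hl H. apply le_epsilon. intros eps He.
  destruct (Hl eps He) as [L0 HL0].
  specialize (HL0 _ (Rmax_l L0 L1)). specialize (H _ (Rmax_r L0 L1)).
  set (I := CInt f _ _) in *.
  generalize (re_le_Cmod (I - l)%C) (Rle_abs (Re (I - l)%C)).
  replace (Re (I - l)%C) with (Re I - Re l) by (simpl; unfold Re; ring). lra.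
Qed.

Lemma J_real_pos (sigma : R) : 0 < sigma -> 0 < Re (J (RtoC sigma)).
Proof.
  (* Limits preserve only weak inequalities; strictness comes from this fixed window. *)
  intros Hs. apply Rlt_le_trans with (RInt (kern_real sigma) (-1) 1).
  - apply RInt_gt_0; [lra | | intros; apply Rcont_kern_real].
    intros x _. unfold kern_real. generalize (exp_pos (x - (sigma + 1 / 2) * eta 0 x)). lra.
  - apply (Re_le_lim (kern (RtoC sigma)) _ _ 1); [now apply is_improper_J|].
    intros L HL. rewrite (CInt_ext _ _ _ _ (kern_RtoC sigma)), CInt_RtoC by apply Rcont_kern_real.
    simpl.
    assert (HC : forall a b, ex_RInt (kern_real sigma) a b) by (intros; apply ex_RInt_Rcont, Rcont_kern_real).
    assert (HP : forall a b, a <= b -> 0 <= RInt (kern_real sigma) a b).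
    { intros a b Hab. apply RInt_ge_0; auto. intros x _. unfold kern_real.
      generalize (exp_pos (x - (sigma + 1 / 2) * eta 0 x)). lra. }
    generalize (RInt_Chasles (V := R_CompleteNormedModule) _ (- L) (-1) L (HC _ _) (HC _ _)).
    generalize (RInt_Chasles (V := R_CompleteNormedModule) _ (-1) 1 L (HC _ _) (HC _ _)).
    generalize (HP (- L) (-1) ltac:(lra)) (HP 1 L HL).
    unfold plus; simpl. lra.
Qed.

(** From [cos (tau h) >= 1 - |tau| h >= 1 + |tau| - |tau| e^h] with [h = eta 0 x],
    where multiplying the kernel by [e^h] lowers its parameter by one. *)
Lemma J_Re_lower (sigma tau : R) : 1 < sigma ->
  (1 + Rabs tau) * Re (J (RtoC sigma)) - Rabs tau * Re (J (RtoC (sigma - 1))) <= Re (J (sigma, tau)).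
Proof.
  intros Hs.
  set (k := fun x => (kern (sigma, tau) x + (RtoC (- (1 + Rabs tau)) * kern (RtoC sigma) x
      + RtoC (Rabs tau) * kern (RtoC (sigma - 1)) x))%C).
  assert (HC1 : forall u v, Ccont (fun x => (u * kern v x)%C)).
  { intros u v. apply Ccont_mult; [apply Ccont_const | apply Ccont_kern]. }
  assert (Hk : is_improper k (J (sigma, tau) + (RtoC (- (1 + Rabs tau)) * J (RtoC sigma)
      + RtoC (Rabs tau) * J (RtoC (sigma - 1))))%C).
  { apply is_improper_plus; [apply Ccont_kern | now apply Ccont_plus | apply is_improper_J; simpl; lra |].
    apply is_improper_plus; auto; apply is_improper_scal; try apply Ccont_kern; apply is_improper_J; simpl; lra. }
  apply (Re_le_lim _ _ 0 0) in Hk.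
  - revert Hk. simpl. unfold Re. intros Hk. lra.
  - intros L HL. rewrite CInt_components.
    + simpl. apply RInt_ge_0; [lra | |].
      * apply ex_RInt_Rcont. 
        assert (Hkc : Ccont k) by (apply Ccont_plus; [apply Ccont_kern | now apply Ccont_plus]).
        now apply Ccont_components in Hkc.
      * intros x _. change (0 <= Re (k x)). unfold k. rewrite kern_polar, !kern_RtoC.
        replace (kern_real (sigma - 1) x) with (kern_real sigma x * exp (eta 0 x))
          by (unfold kern_real; rewrite Rmult_assoc, <- exp_plus; do 2 f_equal; ring).
        match goal with |- 0 <= Re ?u =>
          replace (Re u) with (kern_real sigma x * (cos (tau * eta 0 x) - 1 + Rabs tau * (exp (eta 0 x) - 1)))
            by (unfold kern_real; simpl; ring) end.
        apply Rmult_le_pos.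
        -- unfold kern_real. generalize (exp_pos (x - (sigma + 1 / 2) * eta 0 x)). lra.
        -- generalize (cos_ge (tau * eta 0 x)) (exp_ineq1_le (eta 0 x)) (Rabs_pos tau).
              rewrite Rabs_mult, (Rabs_pos_eq (eta 0 x)) by apply Rlt_le, eta_pos. nra.
    + apply Ccont_plus; [apply Ccont_kern | now apply Ccont_plus].
Qed.

Lemma J_neq_0_large (w : C) : 1 + Rabs (Im w) < Re w -> J w <> 0.
Proof.
  destruct w as [s t]. simpl. intros H E.
  generalize (Rabs_pos t). intros Ht.
  generalize (J_Re_lower s t ltac:(lra)). rewrite E. change (Re 0) with 0.
  generalize (J_real_pos s ltac:(lra)).
  assert (Hrec : 2 * (s - 1) * Re (J (RtoC (s - 1))) = (2 * (s - 1) + 1) * Re (J (RtoC s))).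
  { generalize (J_rec (RtoC (s - 1)) ltac:(simpl; lra)).
    replace (RtoC (s - 1) + 1)%C with (RtoC s) by (rewrite <- RtoC_plus; f_equal; ring).
    intros K. apply (f_equal Re) in K. revert K. simpl. unfold Re. intros K. lra. }
  set (a := Re (J (RtoC s))) in *. set (b := Re (J (RtoC (s - 1)))) in *. intros Ha Hb.
  (* Eliminating [b] by the recurrence [2 (s - 1) b = (2 s - 1) a] turns the left side into
     [(2 (s - 1) - |t|) a], which is positive because [s - 1 > |t|]. *)
  assert (Hm : 2 * (s - 1) * ((1 + Rabs t) * a - Rabs t * b) <= 0) by nra.
  replace (2 * (s - 1) * ((1 + Rabs t) * a - Rabs t * b)) with
   ((1 + Rabs t) * (2 * (s - 1)) * a - Rabs t * (2 * (s - 1) * b)) in Hm by ring.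
  rewrite Hrec in Hm. nra.
Qed.

Lemma J_neq_0 (w : C) : 0 < Re w -> J w <> 0.
Proof.
  intros Hw E.
  assert (H : forall n : nat, J (w + INR n)%C = 0).
  { induction n as [|n IH].
    - rewrite Cplus_0_r. exact E.
    - assert (Hn : 0 < Re (w + INR n)%C) by (generalize (pos_INR n); simpl; unfold Re in Hw; lra).
      generalize (J_rec _ Hn). rewrite IH, S_INR, RtoC_plus, Cplus_assoc, Cmult_0_r.
      intros K. apply eq_sym in K.
      destruct (Ceq_dec (J (w + INR n + 1)%C) 0) as [|N]; [assumption|].
      exfalso. revert K. apply Cmult_neq_0; [|exact N].
      intros K. apply (f_equal Re) in K. revert K Hn. simpl. unfold Re. intros. lra. }
  destruct (INR_unbounded (1 + Rabs (Im w))) as [n Hn].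
  apply (J_neq_0_large (w + INR n)%C); [|apply H].
  simpl. rewrite Rplus_0_r. unfold Re, Im in *. lra.
Qed.

(** * The case lambda = -1/4 *)

(** The factor [M ^ m] in place of the sharper [M ^ (m - 1)] avoids a predecessor and, with
    [M = Rh], still leaves the error one power below the main term. *)
Lemma pow_diff_le (m : nat) (M a b : R) : 1 <= M -> Rabs a <= M -> Rabs b <= M ->
  Rabs (a ^ m - b ^ m) <= INR m * M ^ m * Rabs (a - b).
Proof.
  intros HM Ha Hb. induction m as [|m IH].
  - simpl. rewrite Rminus_diag, Rabs_R0. lra.
  - rewrite S_INR. simpl pow.
    replace (a * a ^ m - b * b ^ m) with (a * (a ^ m - b ^ m) + (a - b) * b ^ m) by ring.
    eapply Rle_trans; [apply Rabs_triang|]. rewrite !Rabs_mult, <- RPow_abs.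
    assert (Hp : Rabs b ^ m <= M ^ m) by (apply pow_incr; split; [apply Rabs_pos | exact Hb]).
    assert (1 <= M ^ m) by now apply pow_R1_Rle.
    generalize (Rabs_pos a) (Rabs_pos (a ^ m - b ^ m)) (Rabs_pos (a - b)). intros.
    assert (Rabs a * Rabs (a ^ m - b ^ m) <= M * (INR m * M ^ m * Rabs (a - b)))
      by (apply Rmult_le_compat; assumption).
    assert (Rabs (a - b) * Rabs b ^ m <= Rabs (a - b) * (M * M ^ m)).
    { apply Rmult_le_compat_l; [assumption|]. nra. }
    nra.
Qed.

Lemma RInt_abs_le (f g : R -> R) (a b : R) : a <= b -> Rcont f -> Rcont g ->
  (forall x, a <= x <= b -> Rabs (f x) <= g x) -> Rabs (RInt f a b) <= RInt g a b.
Proof.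
  intros Hab Hf Hg H. rewrite <- Cmod_R, <- CInt_RtoC by exact Hf.
  apply Cmod_CInt_le; auto; [now apply Ccont_RtoC|].
  intros x Hx. rewrite Cmod_R. auto.
Qed.

(** The integrand at [lambda = -1/4] after the substitution [theta], up to the
    factor [exp (- Rh / 2)]; on [[0, Rh]] it is close to [2 (Rh - 2 x) ^ m]. *)
Definition kern_crit (m : nat) (Rh x : R) : R :=
  (Rh + eta Rh x - eta 0 x) ^ m * (2 * exp (x - eta Rh x / 2 - eta 0 x / 2)).

Lemma Rcont_id : Rcont (fun x => x).
Proof. intros x. apply continuous_id. Qed.

Lemma Rcont_exp (f : R -> R) : Rcont f -> Rcont (fun x => exp (f x)).
Proof.
  intros Hf. apply (Rcont_comp f exp Hf). apply Rcont_derive. intros x. auto_derive. exact I.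
Qed.

Lemma Rcont_kern_crit (m : nat) (Rh : R) : Rcont (kern_crit m Rh).
Proof.
  apply Rcont_mult.
  - apply Rcont_pow. apply Rcont_minus; [apply Rcont_plus|]; try apply Rcont_eta. apply Rcont_const.
  - apply Rcont_mult; [apply Rcont_const|]. apply Rcont_exp.
    apply Rcont_minus; [apply Rcont_minus|]; [apply Rcont_id | |];
      (apply Rcont_mult; [apply Rcont_eta | apply Rcont_const]).
Qed.

Lemma log_pois_bound (Rh x : R) : 0 <= Rh -> Rabs (Rh + eta Rh x - eta 0 x) <= Rh.
Proof.
  intros H. apply Rabs_le. generalize (eta_le_0 Rh x H) (eta_0_le Rh x H). lra.
Qed.

Lemma kern_crit_abs (m : nat) (Rh x : R) : 0 <= Rh ->
  Rabs (kern_crit m Rh x) <= Rh ^ m * (2 * exp (x - eta Rh x / 2 - eta 0 x / 2)).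
Proof.
  intros H. unfold kern_crit. generalize (exp_pos (x - eta Rh x / 2 - eta 0 x / 2)). intros He.
  rewrite Rabs_mult, (Rabs_pos_eq (2 * _)), <- RPow_abs by lra.
  apply Rmult_le_compat_r; [lra|]. apply pow_incr. split; [apply Rabs_pos | now apply log_pois_bound].
Qed.

Lemma kern_crit_left (m : nat) (Rh L : R) : 0 <= Rh -> 0 <= L ->
  Rabs (RInt (kern_crit m Rh) (- L) 0) <= 2 * Rh ^ m.
Proof.
  intros HR HL. assert (0 <= Rh ^ m) by now apply pow_le.
  apply Rle_trans with (RInt (fun x => Rh ^ m * (2 * exp x)) (- L) 0).
  - apply RInt_abs_le; [lra | apply Rcont_kern_crit | |].
    + apply Rcont_mult; [apply Rcont_const|]. apply Rcont_mult; [apply Rcont_const|].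
      apply Rcont_exp, Rcont_id.
    + intros x Hx. eapply Rle_trans; [now apply kern_crit_abs|].
      apply Rmult_le_compat_l; [assumption|]. apply Rmult_le_compat_l; [lra|]. apply exp_le.
      generalize (eta_pos Rh x) (eta_pos 0 x). lra.
  - rewrite (is_RInt_unique (V := R_CompleteNormedModule) _ _ _
      (minus (Rh ^ m * (2 * exp 0)) (Rh ^ m * (2 * exp (- L))))).
    + unfold minus, plus, opp; simpl. rewrite exp_0. generalize (exp_pos (- L)). nra.
    + apply (is_RInt_derive (V := R_CompleteNormedModule) (fun x => Rh ^ m * (2 * exp x))).
      * intros x _. auto_derive; [exact I | ring].
      * intros x _. apply Rcont_derive. intros y. auto_derive. exact I.
Qed.

(** Beyond [Rh], [eta Rh x >= 2 (x - Rh)] and [eta 0 x >= 2 x] bound the exponent by [Rh - x]; the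
    contribution has one power of [Rh] less than the main term, as on the left. *)
Lemma kern_crit_right (m : nat) (Rh L : R) : 0 <= Rh <= L ->
  Rabs (RInt (kern_crit m Rh) Rh L) <= 2 * Rh ^ m.
Proof.
  intros HR. assert (0 <= Rh ^ m) by now apply pow_le.
  apply Rle_trans with (RInt (fun x => Rh ^ m * (2 * exp (Rh - x))) Rh L).
  - apply RInt_abs_le; [lra | apply Rcont_kern_crit | |].
    + apply Rcont_derive. intros y. auto_derive. exact I.
    + intros x Hx. eapply Rle_trans; [now apply kern_crit_abs|].
      apply Rmult_le_compat_l; [assumption|]. apply Rmult_le_compat_l; [lra|]. apply exp_le.
      generalize (eta_ge Rh x) (eta_ge 0 x). lra.
  - rewrite (is_RInt_unique (V := R_CompleteNormedModule) _ _ _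
      (minus (- (Rh ^ m * (2 * exp (Rh - L)))) (- (Rh ^ m * (2 * exp (Rh - Rh)))))).
    + unfold minus, plus, opp; simpl. rewrite Rminus_diag, exp_0. generalize (exp_pos (Rh - L)). nra.
    + apply (is_RInt_derive (V := R_CompleteNormedModule) (fun x => - (Rh ^ m * (2 * exp (Rh - x))))).
      * intros x _. auto_derive; [exact I | unfold Rminus; ring].
      * intros x _. apply Rcont_derive. intros y. auto_derive. exact I.
Qed.

(** By the reflection [eta 0 x = 2 x + eta 0 (- x)]. *)
Lemma eta_0_shift (x : R) : 2 * x <= eta 0 x <= 2 * x + exp (- (2 * x)).
Proof.
  split; [generalize (eta_ge 0 x); lra|].
  replace (eta 0 x) with (2 * x + eta 0 (- x)).
  - generalize (eta_le_exp 0 (- x)). replace (2 * (- x - 0)) with (- (2 * x)) by ring. lra.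
  - rewrite <- (ln_exp (2 * x + eta 0 (- x))), exp_plus, exp_eta. unfold eta. f_equal.
    rewrite Rmult_plus_distr_l, <- exp_plus.
    replace (2 * x + 2 * (- x - 0)) with 0 by ring. rewrite exp_0.
    replace (2 * (x - 0)) with (2 * x) by ring. ring.
Qed.

Lemma kern_crit_middle_pointwise (m : nat) (Rh x : R) : 1 <= Rh -> 0 <= x <= Rh ->
  Rabs (kern_crit m Rh x - 2 * (Rh - 2 * x) ^ m) <=
    (2 * INR m + 1) * Rh ^ m * (exp (2 * (x - Rh)) + exp (- (2 * x))).
Proof.
  intros HR Hx. unfold kern_crit.
  set (D := exp (2 * (x - Rh)) + exp (- (2 * x))).
  set (y := Rh + eta Rh x - eta 0 x). set (y0 := Rh - 2 * x).
  set (u := eta Rh x / 2 + (eta 0 x - 2 * x) / 2).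
  replace (x - eta Rh x / 2 - eta 0 x / 2) with (- u) by (unfold u; field).
  generalize (eta_0_shift x) (eta_pos Rh x) (eta_le_exp Rh x)
    (exp_pos (2 * (x - Rh))) (exp_pos (- (2 * x))). intros E1 E2 E3 E4 E5.
  assert (Hy : Rabs y <= Rh) by (apply log_pois_bound; lra).
  assert (Hy0 : Rabs y0 <= Rh) by (apply Rabs_le; unfold y0; lra).
  assert (Hd : Rabs (y - y0) <= D) by (apply Rabs_le; unfold y, y0, D; lra).
  assert (Hu : 0 <= u <= D / 2) by (unfold u, D; lra).
  assert (He : 1 - u <= exp (- u) <= 1).
  { split; [generalize (exp_ineq1_le (- u)); lra|]. generalize (exp_le (- u) 0). rewrite exp_0. lra. }
  generalize (pow_diff_le m Rh y y0 HR Hy Hy0). intros Hp.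
  assert (Hq : Rabs (y0 ^ m) <= Rh ^ m).
  { rewrite <- RPow_abs. apply pow_incr. split; [apply Rabs_pos | exact Hy0]. }
  (* The first summand is at most [2 m Rh^m D] by [pow_diff_le], the second at most
     [2 u Rh^m <= D Rh^m]. *)
  replace (y ^ m * (2 * exp (- u)) - 2 * y0 ^ m) with
    ((y ^ m - y0 ^ m) * (2 * exp (- u)) + y0 ^ m * (2 * exp (- u) - 2)) by ring.
  assert (0 < Rh ^ m) by (apply pow_lt; lra).
  generalize (pos_INR m) (exp_pos (- u)). intros Hm Heu.
  eapply Rle_trans; [apply Rabs_triang|]. rewrite !Rabs_mult.
  rewrite (Rabs_pos_eq 2), (Rabs_pos_eq (exp (- u))), (Rabs_left1 (2 * exp (- u) - 2)) by lra.
  assert (A1 : Rabs (y ^ m - y0 ^ m) * (2 * exp (- u)) <= (INR m * Rh ^ m * D) * 2).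
  { apply Rmult_le_compat; try lra; [apply Rabs_pos|].
    eapply Rle_trans; [exact Hp|]. apply Rmult_le_compat_l; [nra | exact Hd]. }
  assert (A2 : Rabs (y0 ^ m) * - (2 * exp (- u) - 2) <= Rh ^ m * D).
  { apply Rmult_le_compat; try lra. apply Rabs_pos. }
  lra.
Qed.

(** As [2 n + 1] is odd, the two end values of the antiderivative add up instead of cancelling. The
    error constant survives integration because [e^(2 (x - Rh)) + e^(- 2 x)] has integral at most 1
    over [[0, Rh]]. *)
Lemma kern_crit_middle (n : nat) (Rh : R) : 1 <= Rh ->
  Rabs (RInt (kern_crit (2 * n) Rh) 0 Rh - 2 * Rh ^ (2 * n + 1) / INR (2 * n + 1)) <=
    (2 * INR (2 * n) + 1) * Rh ^ (2 * n).
Proof.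
  intros HR.
  assert (Hi : INR (2 * n + 1) <> 0) by (apply not_0_INR; lia).
  assert (Hc : Rcont (fun x => 2 * (Rh - 2 * x) ^ (2 * n))).
  { apply Rcont_derive. intros x. auto_derive. exact I. }
  assert (E : RInt (fun x => 2 * (Rh - 2 * x) ^ (2 * n)) 0 Rh = 2 * Rh ^ (2 * n + 1) / INR (2 * n + 1)).
  { rewrite (is_RInt_unique (V := R_CompleteNormedModule) _ _ _
      (minus (- ((Rh - 2 * Rh) ^ (2 * n + 1) / INR (2 * n + 1)))
             (- ((Rh - 2 * 0) ^ (2 * n + 1) / INR (2 * n + 1))))).
    - unfold minus, plus, opp; simpl minus. rewrite Rmult_0_r, Rminus_0_r.
      replace (Rh - 2 * Rh) with (- Rh) by ring. rewrite !pow_add, !pow_mult, !pow_1.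
      replace ((- Rh) ^ 2) with (Rh ^ 2) by ring.
      simpl plus. change (- (((Rh ^ 2) ^ n * - Rh) / INR (2 * n + 1)) + - - ((Rh ^ 2) ^ n * Rh / INR (2 * n + 1)) =
         2 * ((Rh ^ 2) ^ n * Rh) / INR (2 * n + 1)). field. exact Hi.
    - apply (is_RInt_derive (V := R_CompleteNormedModule)
        (fun x => - ((Rh - 2 * x) ^ (2 * n + 1) / INR (2 * n + 1)))).
      + intros x _. auto_derive; [exact I|].
        change (n + (n + 0) + 1)%nat with (2 * n + 1)%nat.
        replace (pred (2 * n + 1)) with (2 * n)%nat by lia.
        change (Rh + - (2 * x)) with (Rh - 2 * x). field. exact Hi.
      + intros x _. apply Hc. }
  rewrite <- E.
  set (K := (2 * INR (2 * n) + 1) * Rh ^ (2 * n)).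
  assert (HK : 0 <= K).
  { unfold K. apply Rmult_le_pos; [generalize (pos_INR (2 * n)); lra | apply pow_le; lra]. }
  assert (Es : RInt (kern_crit (2 * n) Rh) 0 Rh - RInt (fun x => 2 * (Rh - 2 * x) ^ (2 * n)) 0 Rh =
     RInt (fun x => kern_crit (2 * n) Rh x - 2 * (Rh - 2 * x) ^ (2 * n)) 0 Rh).
  { symmetry. apply (RInt_minus (V := R_CompleteNormedModule)); apply ex_RInt_Rcont;
      [apply Rcont_kern_crit | exact Hc]. }
  rewrite Es.
  apply Rle_trans with (RInt (fun x => K * (exp (2 * (x - Rh)) + exp (- (2 * x)))) 0 Rh).
  - apply RInt_abs_le; [lra | apply Rcont_minus; [apply Rcont_kern_crit | exact Hc] | |].
    + apply Rcont_derive. intros x. auto_derive. exact I.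
    + intros x Hx. now apply kern_crit_middle_pointwise.
  - rewrite (is_RInt_unique (V := R_CompleteNormedModule) _ _ _
      (minus (K * (exp (2 * (Rh - Rh)) / 2 - exp (- (2 * Rh)) / 2))
             (K * (exp (2 * (0 - Rh)) / 2 - exp (- (2 * 0)) / 2)))).
    + unfold minus, plus, opp; simpl. rewrite Rminus_diag, Rmult_0_r, Ropp_0, exp_0.
      generalize (exp_pos (- (2 * Rh))) (exp_pos (2 * (0 - Rh))). nra.
    + apply (is_RInt_derive (V := R_CompleteNormedModule)
        (fun x => K * (exp (2 * (x - Rh)) / 2 - exp (- (2 * x)) / 2))).
      * intros x _. auto_derive; [exact I | unfold Rminus; field].
      * intros x _. apply Rcont_derive. intros y. auto_derive. exact I.
Qed.

(** The constant [5] is [1] from the middle and [2] from each side. The bound is independent of [L],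
    so it passes to the limit without forming the improper integral. *)
Lemma kern_crit_bound (n : nat) (Rh L : R) : 1 <= Rh <= L ->
  Rabs (RInt (kern_crit (2 * n) Rh) (- L) L - 2 * Rh ^ (2 * n + 1) / INR (2 * n + 1)) <=
    (2 * INR (2 * n) + 5) * Rh ^ (2 * n).
Proof.
  intros HR.
  assert (HC : forall a b, ex_RInt (kern_crit (2 * n) Rh) a b) by (intros; apply ex_RInt_Rcont, Rcont_kern_crit).
  generalize (RInt_Chasles (V := R_CompleteNormedModule) _ (- L) 0 L (HC _ _) (HC _ _)).
  generalize (RInt_Chasles (V := R_CompleteNormedModule) _ 0 Rh L (HC _ _) (HC _ _)).
  unfold plus. simpl plus. intros E1 E2.
  generalize (kern_crit_left (2 * n) Rh L ltac:(lra) ltac:(lra)) (kern_crit_right (2 * n) Rh L ltac:(lra))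
     (kern_crit_middle n Rh ltac:(lra)).
  intros B1 B2 B3. rewrite <- E2, <- E1.
  apply Rabs_le_between in B1, B2, B3. apply Rabs_le.
  match goal with |- _ <= ?X <= _ => change X with (RInt (kern_crit (2 * n) Rh) (- L) 0 +
    (RInt (kern_crit (2 * n) Rh) 0 Rh + RInt (kern_crit (2 * n) Rh) Rh L) - 2 * Rh ^ (2 * n + 1) / INR (2 * n + 1)) end.
  lra.
Qed.

Lemma pois_integral_bound (n : nat) (r Rh : R) :
  0 <= r < 1 -> Rh = ln ((1 + r) / (1 - r)) -> 1 <= Rh ->
  exists A : R,
    CInt (fun t => RtoC (ln (pois_ang r t) ^ (2 * n) * exp (ln (pois_ang r t) / 2))) 0 PI =
      RtoC (exp (- Rh / 2) * A) /\
    Rabs (A - 2 * Rh ^ (2 * n + 1) / INR (2 * n + 1)) <= (2 * INR (2 * n) + 5) * Rh ^ (2 * n).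
Proof.
  intros Hr HRh HR.
  set (H := fun y : R => y ^ (2 * n) * exp (y / 2)).
  assert (HH : Rcont H).
  { apply Rcont_mult; [apply Rcont_pow, Rcont_id|]. apply Rcont_exp.
    apply Rcont_mult; [apply Rcont_id | apply Rcont_const]. }
  assert (HF : Rcont (fun t => H (ln (pois_ang r t)))).
  { apply (Rcont_comp _ H); [now apply Rcont_ln_pois_ang | exact HH]. }
  set (V := RInt (fun t => H (ln (pois_ang r t))) 0 PI).
  exists (exp (Rh / 2) * V). split.
  - change (CInt (fun t => RtoC (H (ln (pois_ang r t)))) 0 PI = RtoC (exp (- Rh / 2) * (exp (Rh / 2) * V))).
    rewrite CInt_RtoC by exact HF. rewrite <- Rmult_assoc, <- exp_plus.
    replace (- Rh / 2 + Rh / 2) with 0 by field. now rewrite exp_0, Rmult_1_l.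
  - apply le_epsilon. intros eps He.
    generalize (exp_pos (Rh / 2)). intros Hp.
    destruct (CInt_theta_lim (fun t => RtoC (H (ln (pois_ang r t)))) Rh (eps / exp (Rh / 2))
      (Ccont_RtoC _ HF)) as [L0 HL0]; [now apply Rdiv_lt_0_compat|].
    set (L := Rmax L0 Rh).
    specialize (HL0 L (Rmax_l _ _)). generalize (Rmax_r L0 Rh). fold L. intros HL.
    assert (E : CInt (fun t => RtoC (H (ln (pois_ang r t)))) (theta Rh (- L)) (theta Rh L) =
       RtoC (exp (- Rh / 2) * RInt (kern_crit (2 * n) Rh) (- L) L)).
    { rewrite (CInt_pois_theta (fun y => RtoC (H y)) r Rh) by (trivial; now apply Ccont_RtoC).
      rewrite RtoC_mult, <- CInt_RtoC by apply Rcont_kern_crit.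
      rewrite <- CInt_scal by apply Ccont_RtoC, Rcont_kern_crit.
      apply CInt_ext. intros x. rewrite <- !RtoC_mult. f_equal.
      unfold H, kern_crit. rewrite wt_eta.
      transitivity ((Rh + eta Rh x - eta 0 x) ^ (2 * n) * (2 * (exp (x - Rh - eta Rh x) *
        exp ((Rh + eta Rh x - eta 0 x) / 2)))); [ring|].
      transitivity ((Rh + eta Rh x - eta 0 x) ^ (2 * n) * (2 * (exp (- Rh / 2) *
        exp (x - eta Rh x / 2 - eta 0 x / 2)))); [|ring].
      rewrite <- !exp_plus. do 3 f_equal. field. }
    rewrite E, CInt_RtoC, <- RtoC_minus, Cmod_R in HL0 by exact HF. fold V in HL0.
    apply (Rmult_le_compat_l (exp (Rh / 2))) in HL0; [|lra].
    rewrite <- (Rabs_pos_eq (exp (Rh / 2))) in HL0 at 1 by lra.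
    rewrite <- Rabs_mult in HL0.
    replace (exp (Rh / 2) * (eps / exp (Rh / 2))) with eps in HL0 by (field; lra).
    replace (exp (Rh / 2) * (V - exp (- Rh / 2) * RInt (kern_crit (2 * n) Rh) (- L) L)) with
      (exp (Rh / 2) * V - RInt (kern_crit (2 * n) Rh) (- L) L) in HL0.
    + generalize (kern_crit_bound n Rh L (conj HR HL)). intros B.
      apply Rabs_le_between in B, HL0. apply Rabs_le. lra.
    + rewrite Rmult_minus_distr_l, <- (Rmult_assoc (exp (Rh / 2)) (exp _)), <- exp_plus.
      replace (Rh / 2 + - Rh / 2) with 0 by field. rewrite exp_0. ring.
Qed.

(** * Asymptotics of the polyspherical functions *)

Lemma circle_int_ext (f g : C -> C) : (forall xi, f xi = g xi) -> circle_int f = circle_int g.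
Proof.
  intros H. unfold circle_int. f_equal.
  apply (RInt_ext (V := C_R_CompleteNormedModule)). intros; apply H.
Qed.

(** Off the cut [Re u / Cmod u > -1], so the argument lies strictly between [- PI] and [PI] and its
    half has positive cosine. *)
Lemma Csqrt_Re_pos (u : C) : ~ (Im u = 0 /\ Re u <= 0) -> 0 < Re (Csqrt u).
Proof.
  intros H.
  assert (Hm : 0 < Cmod u).
  { apply Cmod_gt_0. intros ->. apply H. simpl. lra. }
  assert (Hc : 0 < cos (Carg u / 2)).
  { assert (Hb : -1 < Re u / Cmod u <= 1).
    { generalize (re_le_Cmod u) (Cmod2_alt u). intros B E. apply Rabs_le_between in B.
      assert (N : Re u <> - Cmod u).
      { intros N. apply H. rewrite N in E. split; [|lra].
        assert (Im u * Im u = 0) by lra. now destruct (Rmult_integral _ _ H0). }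
      split; apply (Rmult_lt_reg_r (Cmod u)) || apply (Rmult_le_reg_r (Cmod u)); try exact Hm;
        unfold Rdiv; rewrite Rmult_assoc, Rinv_l by lra; lra. }
    assert (Ha : 0 <= acos (Re u / Cmod u) < PI).
    { destruct (acos_bound (Re u / Cmod u)) as [B1 [B2|B2]]; [lra|].
      apply (f_equal cos) in B2. rewrite cos_acos, cos_PI in B2; lra. }
    unfold Carg. destruct Rle_dec; apply cos_gt_0; lra. }
  unfold Csqrt, Cexp. simpl.
  replace (0 * (Carg u / 2) - 1 * 0) with 0 by ring.
  replace (0 * 0 + 1 * (Carg u / 2)) with (Carg u / 2) by ring.
  rewrite exp_0, !Rmult_0_l, Rminus_0_r, Rmult_1_l.
  apply Rmult_lt_0_compat; [now apply sqrt_lt_R0 | exact Hc].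
Qed.

Lemma C_quarter : (1 / 4)%C = RtoC (1 / 4).
Proof. rewrite RtoC_div; [reflexivity | lra]. Qed.

Lemma spec_s_Re_pos (lambda : C) :
  ~ (Im lambda = 0 /\ Re lambda <= - (1 / 4)) -> 0 < Re (spec_s lambda).
Proof.
  intros H. apply Csqrt_Re_pos. rewrite C_quarter. intros [H1 H2]. apply H.
  revert H1 H2. simpl. unfold Re, Im. lra.
Qed.

Lemma Phi_generic (n : nat) (z lambda : C) : lambda <> (- (1 / 4))%C -> in_disk z ->
  Phi n z lambda = (/ (INR (fact n) * (2 * spec_s lambda) ^ n) * (/ RtoC PI *
    CInt (fun t => RtoC (ln (pois_ang (Cmod z) t) ^ n) *
      Cexp ((spec_s lambda + 1 / 2) * ln (pois_ang (Cmod z) t))) 0 PI))%C.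
Proof.
  intros Hl Hz. unfold Phi.
  set (k := (/ (INR (fact n) * (2 * spec_s lambda) ^ n))%C).
  set (H := fun y : R => (RtoC (y ^ n) * Cexp ((spec_s lambda + 1 / 2) * y))%C).
  assert (HH : Ccont H).
  { apply Ccont_mult.
    - apply Ccont_RtoC, Rcont_pow, Rcont_id.
    - apply (Ccont_Cexp _ (fun y => y)), Rcont_id. }
  rewrite (circle_int_ext _ (fun xi => (k * H (ln (poisson z xi)))%C)).
  - rewrite (circle_int_poisson (fun y => (k * H y)%C)) by
      (assumption || (apply Ccont_mult; [apply Ccont_const | assumption])).
    rewrite CInt_scal.
    + unfold H. ring.
    + apply (Ccont_comp _ H); [|exact HH]. apply Rcont_ln_pois_ang. split; [apply Cmod_ge_0 | exact Hz].
  - intros xi. unfold P_poly. destruct (Ceq_dec lambda _) as [|_]; [contradiction|].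
    fold k. unfold H, Rcpow, horo. rewrite Ropp_involutive, RtoC_pow. ring.
Qed.

Lemma Phi_critical (n : nat) (z : C) : in_disk z ->
  Phi n z (- (1 / 4))%C = (/ INR (fact (2 * n)) * (/ RtoC PI *
    CInt (fun t => RtoC (ln (pois_ang (Cmod z) t) ^ (2 * n) *
      exp (ln (pois_ang (Cmod z) t) / 2))) 0 PI))%C.
Proof.
  intros Hz. unfold Phi.
  set (k := (/ INR (fact (2 * n)))%C).
  set (H := fun y : R => RtoC (y ^ (2 * n) * exp (y / 2))).
  assert (HH : Ccont H).
  { apply Ccont_RtoC, Rcont_mult; [apply Rcont_pow, Rcont_id|]. apply Rcont_exp.
    apply Rcont_mult; [apply Rcont_id | apply Rcont_const]. }
  rewrite (circle_int_ext _ (fun xi => (k * H (ln (poisson z xi)))%C)).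
  - rewrite (circle_int_poisson (fun y => (k * H y)%C)) by
      (assumption || (apply Ccont_mult; [apply Ccont_const | assumption])).
    rewrite CInt_scal.
    + unfold H. ring.
    + apply (Ccont_comp _ H); [|exact HH]. apply Rcont_ln_pois_ang. split; [apply Cmod_ge_0 | exact Hz].
  - intros xi. unfold P_poly. destruct (Ceq_dec _ _) as [_|N]; [|now contradiction N].
    fold k. unfold H, Rcpow, horo. rewrite RtoC_mult, <- RtoC_pow, <- Cexp_RtoC, C_half, <- RtoC_mult.
    replace ((- ln (poisson z xi)) ^ (2 * n)) with (ln (poisson z xi) ^ (2 * n))
      by (rewrite !pow_mult; f_equal; ring).
    rewrite <- Cmult_assoc. do 4 f_equal. field.
Qed.

Lemma asymp_generic (n : nat) (lambda : C) : ~ (Im lambda = 0 /\ Re lambda <= - (1 / 4)) ->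
  asymp_equiv hyp_infty (fun z : C => Phi n z lambda)
    (fun z : C => ((J (spec_s lambda) / RtoC PI) / (INR (fact n) * (2 * spec_s lambda) ^ n)
      * hyp_dist z 0 ^ n * Cexp ((spec_s lambda - 1 / 2) * hyp_dist z 0))%C).
Proof.
  intros Hl. generalize (spec_s_Re_pos lambda Hl). set (s := spec_s lambda). intros Hs.
  assert (Hl' : lambda <> (- (1 / 4))%C).
  { intros ->. apply Hl. rewrite C_quarter. simpl. lra. }
  generalize (J_neq_0 s Hs). intros HJ.
  assert (HJm : 0 < Cmod (J s)) by now apply Cmod_gt_0.
  apply filterlim_C; [apply hyp_infty_proper|]. intros eps He.
  destruct (pois_integral_lim n s (eps / 2 * Cmod (J s)) Hs) as [R0 HR0].
  { apply Rmult_lt_0_compat; lra. }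
  exists (Rmax 1 R0). intros z Hz HR.
  assert (H1 : 1 < hyp_dist z 0) by (eapply Rle_lt_trans; [apply Rmax_l | exact HR]).
  assert (H2 : R0 <= hyp_dist z 0) by (apply Rlt_le; eapply Rle_lt_trans; [apply Rmax_r | exact HR]).
  destruct (HR0 (Cmod z) (hyp_dist z 0) (conj (Cmod_ge_0 z) Hz) (hyp_dist_0 z) H2) as [A [HA E]].
  rewrite (Phi_generic n z lambda Hl' Hz). fold s. rewrite E.
  rewrite <- RtoC_pow.
  assert (Hpi : RtoC PI <> 0) by (apply RtoC_neq_0, PI_neq0).
  assert (Hf : RtoC (INR (fact n)) <> 0) by (apply RtoC_neq_0, INR_fact_neq_0).
  assert (Hs2 : ((2 * s) ^ n)%C <> 0).
  { apply Cpow_nz. intros K. apply (f_equal Re) in K. change (2 * Re s - 0 * Im s = 0) in K. lra. }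
  assert (Hp : RtoC (hyp_dist z 0 ^ n) <> 0) by (apply RtoC_neq_0, pow_nonzero; lra).
  generalize (Cexp_neq_0 ((s - 1 / 2) * hyp_dist z 0)%C).
  set (X := Cexp _) in *. set (Y := RtoC (hyp_dist z 0 ^ n)) in *. set (W := ((2 * s) ^ n)%C) in *.
  intros HX.
  (* All normalising factors cancel; dividing by [J s] is where its non-vanishing enters. *)
  match goal with |- Cmod ?e < _ => replace e with ((A - J s) / J s)%C by (field; tauto) end.
  rewrite Cmod_div by exact HJ.
  apply Rle_lt_trans with (eps / 2); [|lra].
  apply (Rmult_le_reg_r (Cmod (J s))); [exact HJm|].
  unfold Rdiv at 1. rewrite Rmult_assoc, Rinv_l, Rmult_1_r by lra. exact HA.
Qed.

Lemma asymp_critical (n : nat) :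
  asymp_equiv hyp_infty (fun z : C => Phi n z (- (1 / 4))%C)
    (fun z : C => RtoC (2 / (INR (fact (2 * n + 1)) * PI)
       * hyp_dist z 0 ^ (2 * n + 1) * exp (- hyp_dist z 0 / 2))).
Proof.
  apply filterlim_C; [apply hyp_infty_proper|]. intros eps He.
  (* The error bound of [pois_integral_bound] divided by its main term is [K / Rh]. *)
  set (K := (2 * INR (2 * n) + 5) * INR (2 * n + 1) / 2).
  exists (Rmax 1 (K / eps)). intros z Hz HR.
  set (Rh := hyp_dist z 0) in *.
  assert (H1 : 1 < Rh) by (eapply Rle_lt_trans; [apply Rmax_l | exact HR]).
  assert (H2 : K / eps < Rh) by (eapply Rle_lt_trans; [apply Rmax_r | exact HR]).
  destruct (pois_integral_bound n (Cmod z) Rh (conj (Cmod_ge_0 z) Hz) (hyp_dist_0 z) (Rlt_le _ _ H1))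
    as [A [E HA]].
  rewrite (Phi_critical n z Hz), E.
  replace (fact (2 * n + 1)) with ((2 * n + 1) * fact (2 * n))%nat
    by (rewrite Nat.add_1_r; reflexivity).
  rewrite mult_INR.
  assert (Hn : 0 < INR (2 * n + 1)) by (apply lt_0_INR; lia).
  set (N := INR (2 * n + 1)) in *.
  generalize (INR_fact_lt_0 (2 * n)) PI_RGT_0 (exp_pos (- Rh / 2)). intros F1 F2 F3.
  assert (Hp : 0 < Rh ^ (2 * n)) by (apply pow_lt; lra).
  rewrite <- !RtoC_inv, <- !RtoC_mult by lra.
  replace (Rh ^ (2 * n + 1)) with (Rh ^ (2 * n) * Rh) in * by (rewrite pow_add; ring).
  assert (Hd : 2 / (N * INR (fact (2 * n)) * PI) * (Rh ^ (2 * n) * Rh) * exp (- Rh / 2) <> 0).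
  { assert (0 < N * INR (fact (2 * n)) * PI)
      by (apply Rmult_lt_0_compat; [now apply Rmult_lt_0_compat | exact F2]).
    apply Rgt_not_eq, Rmult_lt_0_compat; [|exact F3].
    apply Rmult_lt_0_compat; [apply Rdiv_lt_0_compat; lra | apply Rmult_lt_0_compat; lra]. }
  rewrite <- RtoC_div, <- RtoC_minus, Cmod_R by exact Hd.
  set (Q := Rh ^ (2 * n)) in *. set (P := INR (fact (2 * n))) in *.
  match goal with |- Rabs ?e < _ => replace e with ((A - 2 * (Q * Rh) / N) * (N / (2 * (Q * Rh))))
    by (field; repeat split; lra) end.
  assert (HQR : 0 < Q * Rh) by (apply Rmult_lt_0_compat; lra).
  assert (Hq : 0 < N / (2 * (Q * Rh))) by (apply Rdiv_lt_0_compat; lra).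
  rewrite Rabs_mult, (Rabs_pos_eq (N / _)) by lra.
  eapply Rle_lt_trans; [apply Rmult_le_compat_r; [lra | exact HA]|].
  replace ((2 * INR (2 * n) + 5) * Q * (N / (2 * (Q * Rh)))) with (K / Rh)
    by (unfold K; field; repeat split; lra).
  apply (Rmult_lt_reg_r Rh); [lra|]. unfold Rdiv. rewrite Rmult_assoc, Rinv_l, Rmult_1_r by lra.
  apply (Rmult_lt_compat_l eps) in H2; [|exact He].
  replace (eps * (K / eps)) with K in H2 by (field; lra). exact H2.
Qed.

(** If [f z = 0], the quotient [f z / g z] is 0 whatever [g z] is, at distance 1 from its limit. *)
Lemma asymp_equiv_neq_0 (f g : C -> C) : asymp_equiv hyp_infty f g ->
  exists r, 0 < r < 1 /\ forall z, in_disk z -> r <= Cmod z -> f z <> 0.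
Proof.
  intros H. unfold asymp_equiv in H. rewrite (filterlim_C hyp_infty) in H.
  destruct (H (1 / 2)) as [M HM]; [lra|].
  set (t := exp (Rmax M 0 + 1)).
  assert (Ht : 1 < t).
  { rewrite <- exp_0. apply exp_increasing. generalize (Rmax_r M 0); lra. }
  (* The modulus at hyperbolic distance [ln t = Rmax M 0 + 1] from the origin; the maximum with 0
     makes it positive. *)
  exists ((t - 1) / (t + 1)). split.
  { split; [apply Rdiv_lt_0_compat; lra | apply (Rdiv_lt_1 (t - 1) (t + 1)); lra]. }
  intros z Hz Hr E. unfold in_disk in Hz.
  assert (Hd : M < hyp_dist z 0).
  { rewrite hyp_dist_0. apply Rlt_le_trans with (ln t).
    - unfold t. rewrite ln_exp. generalize (Rmax_l M 0). lra.
    - apply ln_le; [lra|]. apply (Rmult_le_reg_r (1 - Cmod z)); [lra|].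
      unfold Rdiv at 1. rewrite Rmult_assoc, Rinv_l, Rmult_1_r by lra.
      apply (Rmult_le_compat_l (t + 1)) in Hr; [|lra].
      replace ((t + 1) * ((t - 1) / (t + 1))) with (t - 1) in Hr by (field; lra). lra. }
  specialize (HM z Hz Hd). rewrite E in HM. unfold Cdiv in HM. rewrite Cmult_0_l in HM.
  replace (0 - 1)%C with (- (1))%C in HM by ring. rewrite Cmod_m1 in HM. lra.
Qed.

Theorem theorem3p4 :
  (exists c : C -> C,
    forall lambda : C,
      ~ (Im lambda = 0 /\ Re lambda <= - (1 / 4)) ->
      c lambda <> RtoC 0 /\
      forall n : nat,
        asymp_equiv hyp_infty
          (fun z : C => Phi n z lambda)
          (fun z : C =>
             (c lambda / (INR (fact n) * (2 * spec_s lambda) ^ n)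
              * hyp_dist z 0 ^ n
              * Cexp ((spec_s lambda - 1 / 2) * hyp_dist z 0))%C))
  /\
  (forall n : nat,
     asymp_equiv hyp_infty
       (fun z : C => Phi n z (- (1 / 4))%C)
       (fun z : C =>
          RtoC (2 / (INR (fact (2 * n + 1)) * PI)
                * hyp_dist z 0 ^ (2 * n + 1)
                * exp (- hyp_dist z 0 / 2))))
  /\
  (forall (n : nat) (lambda : C),
     (1 <= n)%nat ->
     ~ (Im lambda = 0 /\ Re lambda < - (1 / 4)) ->
     exists r : R,
       0 < r < 1 /\
       forall z : C, in_disk z -> r <= Cmod z -> Phi n z lambda <> RtoC 0).
Proof.
  split; [|split].
  - exists (fun lambda => (J (spec_s lambda) / RtoC PI)%C). intros lambda Hl. split.
    + intros E. apply (J_neq_0 (spec_s lambda) (spec_s_Re_pos lambda Hl)).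
      assert (Hpi : RtoC PI <> 0) by (apply RtoC_neq_0, PI_neq0).
      replace (J (spec_s lambda)) with (J (spec_s lambda) / RtoC PI * RtoC PI)%C by (field; exact Hpi).
      now rewrite E, Cmult_0_l.
    + intros n. now apply asymp_generic.
  - exact asymp_critical.
  - intros n lambda _ Hl.
    (* The endpoint [-1/4], which (A) excludes, is supplied by (B). *)
    destruct (Ceq_dec lambda (- (1 / 4))%C) as [-> | N].
    + exact (asymp_equiv_neq_0 _ _ (asymp_critical n)).
    + apply (asymp_equiv_neq_0 _ _ (asymp_generic n lambda ltac:(
        intros [H1 [H2|H2]]; [now apply Hl|]; apply N; rewrite C_quarter, <- RtoC_opp;
        now apply injective_projections))).
Qed.
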